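(* Let $n\ge 3$ and let $\mathfrak{g}_{C_n}$ be the dynamical Lie algebra of QAOA-MaxCut on the $n$-vertex cycle graph. Then $\mathfrak{g}_{C_n}$ has a direct sum decomposition (as a Lie algebra) $$\mathfrak{g}_{C_n}=\mathfrak{c}\oplus\mathfrak{g}_1\oplus\cdots\oplus\mathfrak{g}_{n-1},$$ where each $\mathfrak{g}_j\cong\mathfrak{su}(2)$ and the center is $\mathfrak{c}=\mathrm{span}_{\mathbb{R}}\{c_1,c_2\}$, where $$c_1=-X+\sum_{t=1}^{\frac{n-1}{2}}\big(ZX^{2t-1}Z+YX^{2t-1}Y\big),\qquad c_2=X^{n-1}+\sum_{t=0}^{\frac{n-3}{2}}\big(ZX^{2t}Z+YX^{2t}Y\big)$$ if $n$ is odd, and $$c_1=X^{n-1}-X+\sum_{t=1}^{\frac{n-2}{2}}\big(ZX^{2t-1}Z+YX^{2t-1}Y\big),\qquad c_2=\sum_{t=0}^{\frac{n-2}{2}}\big(ZX^{2t}Z+YX^{2t}Y\big)$$ if $n$ is even.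
   Context: Qubits are indexed by $\mathbb{Z}_n=\{0,\dots,n-1\}$ with subscripts taken modulo $n$; $X_j,Y_j,Z_j$ are the Pauli matrices acting on qubit $j$ (identity elsewhere). $\mathfrak{g}_{C_n}\subseteq\mathfrak{su}(2^n)$ is the real Lie algebra (bracket $[A,B]=AB-BA$) generated by $i\sum_{j=0}^{n-1}X_j$ and $i\sum_{j=0}^{n-1}Z_jZ_{j+1}$. The following are single symbols (not products of matrices) denoting $2^n\times2^n$ matrices: $X=i\sum_{j=0}^{n-1}X_j$; $X^{n-1}=i\sum_{j=0}^{n-1}X_jX_{j+1}\cdots X_{j+n-2}$; and for $0\le t\le n-2$, $ZX^tZ=i\sum_{j=0}^{n-1}Z_jX_{j+1}\cdots X_{j+t}Z_{j+t+1}$, $YX^tY=i\sum_{j=0}^{n-1}Y_jX_{j+1}\cdots X_{j+t}Y_{j+t+1}$ (for $t=0$ there are no $X$ factors). A Lie algebra direct sum means a vector space direct sum in which different summands commute. *)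

(* Defs.v *)
From HB Require Import structures.
From mathcomp Require Import all_boot all_order all_algebra.
From mathcomp Require Import complex.
From mathcomp Require Import classical_sets functions reals.

Set Implicit Arguments.
Unset Strict Implicit.
Unset Printing Implicit Defensive.

Import Order.TTheory GRing.Theory Num.Theory.

Local Open Scope classical_set_scope.
Local Open Scope sesquilinear_scope.
Local Open Scope ring_scope.

Section RealLieAlgebras.
Variable R : realType.

Definition bracket m (A B : 'M[R[i]]_m) : 'M[R[i]]_m := A * B - B * A.

(* The library only makes ['M[R[i]]_m] a module over [R[i]]; its real vector
   space structure is recovered by scaling with [a%:C] for [a : R]. *)
Definition real_subspace m (V : set 'M[R[i]]_m) : Prop :=
  [/\ V 0, forall A B, V A -> V B -> V (A + B) &
      forall (a : R) A, V A -> V (a%:C%C *: A)].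

Definition lie_subalgebra m (L : set 'M[R[i]]_m) : Prop :=
  real_subspace L /\ forall A B, L A -> L B -> L (bracket A B).

Definition lie_generated m (S : set 'M[R[i]]_m) : set 'M[R[i]]_m :=
  smallest (@lie_subalgebra m) S.

Definition lie_center m (L : set 'M[R[i]]_m) : set 'M[R[i]]_m :=
  [set A | L A /\ forall B, L B -> bracket A B = 0].

Definition real_span2 m (A B : 'M[R[i]]_m) : set 'M[R[i]]_m :=
  [set D | exists a b : R, D = a%:C%C *: A + b%:C%C *: B].

Definition su m : set 'M[R[i]]_m := [set A | A^t* = - A /\ \tr A = 0].

(* Only the restriction of [f] to [L] is constrained. *)
Definition lie_isomorphic m p
    (L : set 'M[R[i]]_m) (K : set 'M[R[i]]_p) : Prop :=
  exists f : 'M[R[i]]_m -> 'M[R[i]]_p,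
    [/\ set_bij L K f,
        forall A B, L A -> L B -> f (A + B) = f A + f B,
        forall (a : R) A, L A -> f (a%:C%C *: A) = a%:C%C *: f A &
        forall A B, L A -> L B -> f (bracket A B) = bracket (f A) (f B)].

Definition lie_direct_sum m (I : finType) (L : set 'M[R[i]]_m)
    (V : I -> set 'M[R[i]]_m) : Prop :=
  [/\ forall k, lie_subalgebra (V k),
      L = [set A | exists2 B : I -> 'M[R[i]]_m,
             forall k, V k (B k) & A = \sum_k B k],
      forall B B' : I -> 'M[R[i]]_m,
        (forall k, V k (B k)) -> (forall k, V k (B' k)) ->
        \sum_k B k = \sum_k B' k -> forall k, B k = B' k &
      forall k l, k != l -> forall A B, V k A -> V l B -> bracket A B = 0].

End RealLieAlgebras.

Arguments su R m : clear implicits.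

Section PauliMatrices.
Variables (R : realType) (n : nat).

Definition sigma_x : 'M[R[i]]_2 := \matrix_(a, b) (a != b)%:R.

Definition sigma_y : 'M[R[i]]_2 :=
  \matrix_(a, b) (if a == b then 0 else if a == 0 then - 'i%C else 'i%C).

Definition sigma_z : 'M[R[i]]_2 :=
  \matrix_(a, b) (if a != b then 0 else if a == 0 then 1 else - 1).

(* Qubit [0] is the most significant binary digit of a basis index. *)
Definition qubit_bit (k : 'I_n) (a : 'I_(2 ^ n)) : 'I_2 :=
  inord ((a %/ 2 ^ (n - k.+1)) %% 2)%N.

(* The Kronecker product of [P 0], ..., [P (n - 1)], given by its entries. *)
Definition kron (P : 'I_n -> 'M[R[i]]_2) : 'M[R[i]]_(2 ^ n) :=
  \matrix_(a, b) \prod_(k < n) P k (qubit_bit k a) (qubit_bit k b).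

(* [P] acting on qubit [j], where [j] is read modulo [n]. *)
Definition on_qubit (P : 'M[R[i]]_2) (j : nat) : 'M[R[i]]_(2 ^ n) :=
  kron (fun k => if (k == j %% n :> nat)%N then P else 1).

Definition pauliX := on_qubit sigma_x.
Definition pauliY := on_qubit sigma_y.
Definition pauliZ := on_qubit sigma_z.

Definition sumX : 'M[R[i]]_(2 ^ n) := 'i%C *: \sum_(0 <= j < n) pauliX j.

Definition sumZZ : 'M[R[i]]_(2 ^ n) :=
  'i%C *: \sum_(0 <= j < n) pauliZ j * pauliZ j.+1.

(* The symbol X^{n-1}; not a matrix power. *)
Definition sumXn1 : 'M[R[i]]_(2 ^ n) :=
  'i%C *: \sum_(0 <= j < n) \prod_(0 <= s < n.-1) pauliX (j + s).

(* The symbols ZX^tZ and YX^tY. *)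
Definition sumZXZ (t : nat) : 'M[R[i]]_(2 ^ n) :=
  'i%C *: \sum_(0 <= j < n)
    pauliZ j * (\prod_(1 <= s < t.+1) pauliX (j + s)) * pauliZ (j + t.+1).

Definition sumYXY (t : nat) : 'M[R[i]]_(2 ^ n) :=
  'i%C *: \sum_(0 <= j < n)
    pauliY j * (\prod_(1 <= s < t.+1) pauliX (j + s)) * pauliY (j + t.+1).

Definition g_cycle : set 'M[R[i]]_(2 ^ n) :=
  lie_generated [set sumX; sumZZ].

Definition c1 : 'M[R[i]]_(2 ^ n) :=
  if odd n then
    - sumX + \sum_(1 <= t < ((n - 1) %/ 2).+1)
               (sumZXZ (2 * t - 1)%N + sumYXY (2 * t - 1)%N)
  else
    sumXn1 - sumX + \sum_(1 <= t < ((n - 2) %/ 2).+1)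
                      (sumZXZ (2 * t - 1)%N + sumYXY (2 * t - 1)%N).

Definition c2 : 'M[R[i]]_(2 ^ n) :=
  if odd n then
    sumXn1 + \sum_(0 <= t < ((n - 3) %/ 2).+1)
               (sumZXZ (2 * t)%N + sumYXY (2 * t)%N)
  else
    \sum_(0 <= t < ((n - 2) %/ 2).+1) (sumZXZ (2 * t)%N + sumYXY (2 * t)%N).

End PauliMatrices.

Arguments g_cycle R n : clear implicits.

(* Main.v *)
Require Import Defs.
From mathcomp Require Import all_boot all_order all_algebra.
From mathcomp Require Import complex.
From mathcomp Require Import classical_sets reals.
From mathcomp Require Import cyclic separable cyclotomic.
From mathcomp Require Import zify ring lra.

(** The Jordan-Wigner transformation turns the generators into quadratic
    expressions in Majorana operators.  Put
    [A_k = i sum_j Z_j X_{j+1} ... X_{j+k-1} Z_{j+k}] for [1 <= k <= 2n]; since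
    the product of all [X_j] is an involution [P], the strings that wrap around
    the cycle reduce to those of [X^{n-1}], [YX^tY] and [-X].  For
    [z^{2n} = 1] the Fourier sum [V_z = sum_k z^k A_k] factors as
    [- (1 - z^n P) b a], where [a] and [b] are momentum modes of the two kinds of
    Majorana operators, and the canonical anticommutation relations give
    [[V_z, V_w] = 0] unless [z w = 1], and
    [[[V_z, V_{1/z}], V_w] = - 32 n^2 (delta_{z,w} - delta_{zw,1}) V_w].
    Hence each pair [{z, 1/z}] with [z^2 <> 1] spans a copy of [sl_2], with real
    form [su(2)], while [V_1 = c_1 + c_2] and [V_{-1} = c_1 - c_2] are central.
    Fourier inversion puts the generators in the sum of these pieces; conversely
    [[[A_1, A_0], A_k] = - 8 (A_{k+1} - A_{k-1})], with [A_0 = A_{2n}], generates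
    every [A_k]. *)

Set Implicit Arguments.
Unset Strict Implicit.
Unset Printing Implicit Defensive.

Import Order.TTheory GRing.Theory Num.Theory.

Local Open Scope classical_set_scope.
Local Open Scope sesquilinear_scope.
Local Open Scope ring_scope.

(** * Pauli matrices on several qubits *)

(** Closing a Jordan-Wigner string around the cycle costs a factor [P], so the momenta depend on the
    parity sector: [z^n = 1] goes with [P = -1], and [z^n = -1] with [P = 1]. Working with all
    [2n]-th roots of unity handles both sectors at once, since [1 - z^n P] is twice the projector
    onto the sector of [z]. Modes with different [z^n] are not orthogonal to each other, but their
    [V_z] still commute because these projectors annihilate each other. The algebra is real while
    the [V_z] are complex. As [1/z] is the conjugate of [z], the elements [V_z + V_{1/z}] and
    [i (V_z - V_{1/z})] are real combinations of the [A_k], and they generate the real form. The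
    [2n - 2] roots with [z^2 <> 1] form [n - 1] pairs. Directness is obtained from brackets instead
    of dimensions: the pieces commute with each other and each copy of [su(2)] is centerless. This
    rests on [V_z <> 0], which a single matrix entry shows. *)

Section MatrixScaling.
Variables (K : comPzRingType) (m : nat).
Implicit Types (c : K) (A B : 'M[K]_m).

Lemma scalemxMl c A B : (c *: A) * B = c *: (A * B).
Proof. exact: esym (scalemxAl c A B). Qed.

Lemma scalemxMr c A B : A * (c *: B) = c *: (A * B).
Proof. exact: esym (scalemxAr c A B). Qed.

Lemma scalar_mx0 : 0%:M = 0 :> 'M[K]_m.
Proof. exact: raddf0. Qed.

Lemma scalar_mulr c A : c%:M * A = c *: A.
Proof. exact: mul_scalar_mx. Qed.

End MatrixScaling.

Lemma scalar_mull (K : comPzRingType) m (c : K) (A : 'M[K]_m) : A * c%:M = c *: A.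
Proof. exact: mul_mx_scalar. Qed.


Section Kronecker.
Variables (R : realType) (n : nat).
Implicit Types P Q : 'I_n -> 'M[R[i]]_2.

Lemma qubit_bit_inj (a b : 'I_(2 ^ n)) :
  (forall k : 'I_n, qubit_bit k a = qubit_bit k b) -> a = b.
Proof.
move=> eqab; apply: val_inj => /=.
suff H m : (m <= n)%N -> (a = b %[mod 2 ^ m])%N.
  by have := H n (leqnn n); rewrite !modn_small.
elim: m => [|m IH] lt_mn; first by rewrite !modn1.
(* Qubit [n - m.+1] holds the binary digit of weight [2 ^ m], so digits are compared from the least
   significant one upward. *)
have lt_kn : (n - m.+1 < n)%N by lia.
have /(congr1 val) /= := eqab (Ordinal lt_kn).
rewrite !inordK ?ltn_pmod //= (_ : n - (n - m.+1).+1 = m)%N; last by lia.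
rewrite !modn_divl mulnC -expnSr => eq_div.
rewrite (divn_eq (a %% 2 ^ m.+1) (2 ^ m)) (divn_eq (b %% 2 ^ m.+1) (2 ^ m)).
by rewrite eq_div !modn_dvdm ?dvdn_exp2l // IH // ltnW.
Qed.

Lemma kronM P Q : kron P * kron Q = kron (fun k => P k * Q k).
Proof.
apply/matrixP => a b; rewrite !mxE.
under eq_bigr do rewrite !mxE -big_split /=.
under [RHS]eq_bigr do rewrite !mxE.
(* Expanding the product of sums gives a sum over all digit strings; [h] identifies these with the
   basis indices, injectively and hence, by cardinality, bijectively. *)
rewrite bigA_distr_bigA /=.
pose h (c : 'I_(2 ^ n)) := [ffun k : 'I_n => qubit_bit k c].
have h_inj : injective h.
  by move=> c d /ffunP eqcd; apply: qubit_bit_inj => k; have := eqcd k; rewrite !ffunE.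
have h_bij : bijective h.
  by apply: inj_card_bij => //; rewrite card_ffun !card_ord.
rewrite [RHS](reindex h) /=; last exact: onW_bij.
by apply: eq_bigr => c _; apply: eq_bigr => k _; rewrite ffunE.
Qed.

Lemma kron1 : kron (fun=> 1) = 1 :> 'M[R[i]]_(2 ^ n).
Proof.
apply/matrixP => a b; rewrite !mxE.
have [<-|neq_ab] := eqVneq a b.
  by rewrite big1 // => k _; rewrite mxE eqxx.
case: (pickP (fun k : 'I_n => qubit_bit k a != qubit_bit k b)) => [k nk|eqk].
  by rewrite (bigD1 k) //= mxE (negbTE nk) mul0r.
case/eqP: neq_ab; apply: qubit_bit_inj => k.
by apply/eqP/negbNE; rewrite eqk.
Qed.

Lemma eq_kron P Q : P =1 Q -> kron P = kron Q.
Proof.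
by move=> eqPQ; apply/matrixP=> a b; rewrite !mxE; apply: eq_bigr=> k; rewrite eqPQ.
Qed.

End Kronecker.

Section Pauli.
Variables (R : realType) (n : nat).
Hypothesis n_gt0 : (0 < n)%N.
Local Notation C := R[i].
Local Notation M := 'M[C]_(2 ^ n).
Implicit Types (A B : 'M[C]_2) (i j m : nat).

Lemma on_qubitM A B j : on_qubit n A j * on_qubit n B j = on_qubit n (A * B) j.
Proof. by rewrite kronM; apply: eq_kron => k; case: eqP; rewrite ?mulr1. Qed.

Lemma on_qubit1 j : on_qubit n 1 j = 1 :> M.
Proof. by rewrite -[RHS]kron1; apply: eq_kron => k; case: eqP. Qed.

Lemma on_qubitZ (c : C) A j : on_qubit n (c *: A) j = c *: on_qubit n A j.
Proof.
have lt_jn : (j %% n < n)%N by rewrite ltn_pmod.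
apply/matrixP => a b; rewrite !mxE.
rewrite (bigD1 (Ordinal lt_jn)) //= [in RHS](bigD1 (Ordinal lt_jn)) //= eqxx.
rewrite mxE -mulrA; congr (_ * (_ * _)); apply: eq_bigr => k; rewrite -val_eqE /=.
by move=> /negbTE ->.
Qed.

Lemma on_qubit_comm A B i j : i != j %[mod n] ->
  on_qubit n A i * on_qubit n B j = on_qubit n B j * on_qubit n A i.
Proof.
move=> neq_ij; rewrite !kronM; apply: eq_kron => k.
have [->|] := eqVneq (k : nat) (i %% n)%N; rewrite ?mulr1 ?mul1r //.
by rewrite (negbTE neq_ij) mulr1 mul1r.
Qed.

Lemma on_qubit_mod A j : on_qubit n A (j %% n) = on_qubit n A j.
Proof. by rewrite /on_qubit modn_mod. Qed.

End Pauli.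

Section Sigma.
Variable R : realType.
Local Notation C := R[i].
Local Notation sX := (sigma_x R).
Local Notation sY := (sigma_y R).
Local Notation sZ := (sigma_z R).

Ltac mx2 := apply/matrixP => -[[|[|//]] ?] -[[|[|//]] ?];
  rewrite !(mxE, big_ord_recl, big_ord0) /= -?val_eqE /=
    ?(mul0r, mulr0, addr0, add0r, mul1r, mulr1, mulrN, mulNr, opprK, oppr0, subrr) //;
  rewrite -?expr2 ?sqr_i ?opprK.

Lemma sigma_xx : sX * sX = 1. Proof. by mx2. Qed.
Lemma sigma_yy : sY * sY = 1. Proof. by mx2. Qed.
Lemma sigma_zz : sZ * sZ = 1. Proof. by mx2. Qed.
Lemma sigma_yx : sY * sX = - 'i%C *: sZ. Proof. by mx2. Qed.
Lemma sigma_xy : sX * sY = 'i%C *: sZ. Proof. by mx2. Qed.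
Lemma sigma_zx : sZ * sX = 'i%C *: sY. Proof. by mx2. Qed.
Lemma sigma_xz : sX * sZ = - 'i%C *: sY. Proof. by mx2. Qed.
Lemma sigma_yz : sY * sZ = 'i%C *: sX. Proof. by mx2. Qed.
Lemma sigma_zy : sZ * sY = - 'i%C *: sX. Proof. by mx2. Qed.
End Sigma.

(** * Majorana operators *)

Lemma big_nat_shift (T : Type) (idx : T) (op : T -> T -> T) (n m : nat) (f : nat -> T) :
  \big[op/idx]_(n <= s < n + m) f s = \big[op/idx]_(0 <= s < m) f (s + n)%N.
Proof. by rewrite -{1}[n]add0n big_addn addKn. Qed.

Section PeriodicSums.
Variable V : nmodType.

Lemma sum_shift_periodic (N c : nat) (f : nat -> V) :
  (forall k, f (k + N)%N = f k) ->
  \sum_(0 <= k < N) f (k + c)%N = \sum_(0 <= k < N) f k.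
Proof.
move=> fN; elim: c => [|c IH]; first by apply: eq_bigr => k _; rewrite addn0.
case: N fN IH => [|N] fN IH; first by rewrite !big_geq.
rewrite -IH big_nat_recr //= [RHS]big_nat_recl //= addrC; congr (_ + _).
  by rewrite -[in RHS]fN; congr (f _); lia.
by apply: eq_bigr => k _; rewrite addSnnS.
Qed.

End PeriodicSums.

Lemma sum_unity_powers (F : fieldType) (N : nat) (z : F) :
  z ^+ N = 1 -> \sum_(0 <= k < N) z ^+ k = if z == 1 then N%:R else 0.
Proof.
move=> zN; case: eqVneq => [->|z_neq1].
  by under eq_bigr do rewrite expr1n; rewrite sumr_const_nat subn0.
have /eqP := subrX1 z N; rewrite zN subrr eq_sym mulf_eq0 subr_eq0 (negbTE z_neq1).
by rewrite big_mkord => /eqP.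
Qed.

Section JordanWigner.
Variables (R : realType) (n : nat).
Hypothesis n_gt0 : (0 < n)%N.
Local Notation C := R[i].
Local Notation M := 'M[C]_(2 ^ n).
Local Notation X := (@pauliX R n).
Local Notation Y := (@pauliY R n).
Local Notation Z := (@pauliZ R n).
Implicit Types (i j k l m : nat) (t u : bool) (z w : C).

Lemma pauliX_sqr j : X j * X j = 1.
Proof. by rewrite /pauliX on_qubitM sigma_xx on_qubit1. Qed.

Lemma pauliX_mod j : X (j %% n) = X j.
Proof. exact: on_qubit_mod. Qed.

Lemma pauliX_comm i j : GRing.comm (X i) (X j).
Proof.
have [eq_ij|neq_ij] := eqVneq (i %% n)%N (j %% n)%N; last exact: on_qubit_comm.
by rewrite /GRing.comm -pauliX_mod eq_ij pauliX_mod.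
Qed.

Definition jw_string m : M := \prod_(0 <= s < m) X s.

Lemma jw_stringS m : jw_string m.+1 = jw_string m * X m.
Proof. by rewrite /jw_string big_nat_recr. Qed.

Lemma jw_string0 : jw_string 0 = 1.
Proof. by rewrite /jw_string big_geq. Qed.

Lemma prodX_comm (r : seq nat) (f : nat -> nat) j :
  GRing.comm (X j) (\prod_(s <- r) X (f s)).
Proof. by apply: commr_prod => s _; apply: pauliX_comm. Qed.

Lemma jw_string_comm m k : GRing.comm (jw_string m) (jw_string k).
Proof. by apply/commr_sym/commr_prod => s _; apply/commr_sym/prodX_comm. Qed.

Lemma jw_string_sqr m : jw_string m * jw_string m = 1.
Proof.
elim: m => [|m IH]; first by rewrite jw_string0 mulr1.
rewrite jw_stringS -mulrA [X m * _]mulrA (prodX_comm _ id m) -!mulrA.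
by rewrite pauliX_sqr mulr1.
Qed.

Definition sigmaZY t : 'M[C]_2 := if t then sigma_z R else sigma_y R.

Lemma sigmaZY_x t : sigmaZY t * sigma_x R = - (sigma_x R * sigmaZY t).
Proof.
by case: t; rewrite /= ?sigma_zx ?sigma_yx ?sigma_xz ?sigma_xy scaleNr ?opprK.
Qed.

Lemma on_qubitN (A : 'M[C]_2) j : on_qubit n (- A) j = - on_qubit n A j.
Proof. by rewrite -[- A]scaleN1r on_qubitZ // scaleN1r. Qed.

(** [X] anticommutes with [Y] and [Z] at its own site and commutes with them elsewhere; within one
    turn the string meets site [m] at most once. *)
Lemma sigmaZY_jw t m k : (m < n)%N -> (k <= n)%N ->
  on_qubit n (sigmaZY t) m * jw_string k =
  (-1) ^+ (m < k)%N *: (jw_string k * on_qubit n (sigmaZY t) m).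
Proof.
move=> lt_mn; elim: k => [|k IH] lt_kn; first by rewrite jw_string0 mulr1 scale1r mul1r.
rewrite jw_stringS mulrA IH ?(ltnW lt_kn) // scalemxMl -!mulrA ltnS.
have [eq_mk|neq_mk] := eqVneq m k.
  rewrite eq_mk ltnn leqnn expr0 scale1r expr1 scaleN1r on_qubitM sigmaZY_x.
  by rewrite on_qubitN -on_qubitM mulrN.
rewrite on_qubit_comm; first by rewrite ltn_neqAle neq_mk.
by rewrite !modn_small.
Qed.

Definition parity : M := jw_string n.

(* The Majorana operators; for [t = true] they are also used at sites [m >= n],
   where they are the translates by the parity operator. *)
Definition majorana t m : M := jw_string m * on_qubit n (sigmaZY t) m.

Lemma majorana_anticomm t u m l : (m < n)%N -> (l < n)%N ->
  majorana t m * majorana u l + majorana u l * majorana t m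
  = (if (t == u) && (m == l) then 2%:R else 0)%:M.
Proof.
move=> lt_mn lt_ln.
(* Collecting the strings on the left costs a sign exactly when [m' < l']. For distinct sites this
   happens in only one of the two orders, so the two products cancel. *)
have maj2 t' u' m' l' : (m' < n)%N -> (l' < n)%N ->
    majorana t' m' * majorana u' l' = (-1) ^+ (m' < l')%N *: (jw_string m' * jw_string l' *
       (on_qubit n (sigmaZY t') m' * on_qubit n (sigmaZY u') l')).
  move=> ltm ltl; rewrite /majorana -mulrA [X in _ * X = _]mulrA sigmaZY_jw ?(ltnW ltl) //.
  by rewrite scalemxMl scalemxMr !mulrA.
rewrite !maj2 // (jw_string_comm l m).
have [<-{l lt_ln}|neq_ml] := eqVneq m l; last first.
  rewrite andbF (on_qubit_comm _ _ (_ : l != m %[mod n])); last first.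
    by rewrite !modn_small // eq_sym.
  rewrite -scalerDl; have [lt_ml|lt_lm|eq_ml] := ltngtP m l.
  - by rewrite expr1 expr0 addNr scale0r scalar_mx0.
  - by rewrite expr1 expr0 addrN scale0r scalar_mx0.
  - by rewrite eq_ml eqxx in neq_ml.
rewrite andbT ltnn !scale1r jw_string_sqr !mul1r !on_qubitM.
have two : 2%:R%:M = 1 + 1 :> M by rewrite -scalemx1 scaler_nat mulr2n.
case: t u => -[] /=; rewrite ?scalar_mx0 ?two ?sigma_zz ?sigma_yy ?sigma_zy ?sigma_yz ?on_qubit1 //.
  by rewrite !on_qubitZ // scaleNr addNr.
by rewrite !on_qubitZ // scaleNr addrN.
Qed.

Lemma parity_sqr : parity * parity = 1.
Proof. exact: jw_string_sqr. Qed.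

Lemma parity_majorana t m : (m < n)%N ->
  majorana t m * parity = - (parity * majorana t m).
Proof.
move=> lt_mn; rewrite /majorana -mulrA sigmaZY_jw // lt_mn scaleN1r mulrN /parity.
by rewrite !mulrA (jw_string_comm m n).
Qed.

(** The first turn of the string is the full product [parity]. Since that squares to 1, these
    operators have period [2 * n] rather than [n]. *)
Lemma majorana_shift m : majorana true (m + n) = parity * majorana true m.
Proof.
rewrite /majorana /parity mulrA; congr (_ * _); last first.
  by rewrite -on_qubit_mod modnDr on_qubit_mod.
rewrite /jw_string addnC [LHS](big_cat_nat (leq0n n)) ?leq_addr //=; congr (_ * _).
rewrite big_nat_shift.
by apply: eq_bigr => s _; rewrite -pauliX_mod modnDr pauliX_mod.
Qed.

Definition majorana_mode t z : M := \sum_(0 <= m < n) z ^+ m *: majorana t m.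

Lemma majorana_mode_anticomm t u z w :
  majorana_mode t z * majorana_mode u w + majorana_mode u w * majorana_mode t z
  = ((\sum_(0 <= m < n) (z * w) ^+ m) * (if t == u then 2%:R else 0))%:M.
Proof.
rewrite /majorana_mode !mulr_suml.
under eq_bigr do rewrite mulr_sumr.
under [X in _ + X]eq_bigr do rewrite mulr_sumr.
rewrite [X in _ + X]exchange_big /= -big_split /=.
transitivity (\sum_(0 <= m < n)
   ((z * w) ^+ m * (if t == u then 2%:R else 0))%:M : M).
  apply: eq_big_nat => m /andP[_ lt_mn]; rewrite -big_split /=.
  rewrite (bigD1_seq m) ?mem_index_iota ?iota_uniq //=.
  have term l : (l < n)%N -> z ^+ m *: majorana t m * (w ^+ l *: majorana u l) +
      w ^+ l *: majorana u l * (z ^+ m *: majorana t m) =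
      (z ^+ m * w ^+ l * (if (t == u) && (m == l) then 2%:R else 0))%:M.
    move=> lt_ln; rewrite !scalemxMl !scalemxMr !scalerA [w ^+ l * _]mulrC -scalerDr.
    by rewrite majorana_anticomm // scale_scalar_mx.
  rewrite term // eqxx andbT big_seq_cond big1 ?addr0.
    by rewrite -exprMn.
  move=> l /andP[]; rewrite mem_index_iota => /andP[_ lt_ln] neq_lm.
  by rewrite term // [m == l]eq_sym (negbTE neq_lm) andbF mulr0 scalar_mx0.
by rewrite -raddf_sum -mulr_suml.
Qed.

Lemma parity_mode t z : majorana_mode t z * parity = - (parity * majorana_mode t z).
Proof.
rewrite /majorana_mode mulr_suml mulr_sumr -sumrN; apply: eq_big_nat => m /andP[_ lt_mn].
by rewrite scalemxMl scalemxMr parity_majorana // scalerN.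
Qed.

End JordanWigner.

(** The brackets to compute are commutators, while the known relations are anticommutators; this
    identity passes from one to the other. *)
Lemma commutator_mul_anticomm (A : pzRingType) (a b c : A) :
  a * b * c - c * (a * b) = a * (b * c + c * b) - (a * c + c * a) * b.
Proof. by rewrite mulrDr mulrDl !mulrA opprD addrA addrK. Qed.

(** * Algebra of momentum modes and parity *)

Section MomentumModes.
Variables (C : fieldType) (m n : nat).
Local Notation A := 'M[C]_m.
Variables (mode : bool -> C -> A) (P : A).
Implicit Types (z w e f : C) (t : bool).

(** The anticommutator of two modes of one kind as a function of the product of their momenta: 2 for
    each of the [n] sites when the phases cancel. *)
Definition resonance z : C := if z == 1 then (2 * n)%:R else 0.

Hypothesis mode_anticomm_ft : forall z w,
  mode true z * mode false w = - (mode false w * mode true z).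
Hypothesis mode_anticomm : forall t z w, (z * w) ^+ n = 1 ->
  mode t z * mode t w + mode t w * mode t z = (resonance (z * w))%:M.
Hypothesis P_sqr : P * P = 1.
Hypothesis mode_P : forall t z, mode t z * P = - (P * mode t z).

(** For [e ^+ 2 = 1], twice the projector onto the eigenspace [P = e]. *)
Definition parity_proj e : A := 1 + e *: P.

Lemma parity_projM e f : e ^+ 2 = 1 -> f ^+ 2 = 1 ->
  parity_proj e * parity_proj f = (if e == f then 2%:R else 0) *: parity_proj e.
Proof.
move=> e2 f2; rewrite /parity_proj mulrDr !mulrDl !mul1r mulr1 scalemxMl !scalemxMr P_sqr.
rewrite scalerA -addrA [f *: P + _]addrC.
have [<-|neq_ef] := eqVneq e f.
  rewrite -expr2 e2 scale1r scaler_nat mulr2n.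
  by rewrite !addrA [1 + e *: P + 1]addrAC -!addrA [X in 1 + X]addrA.
have /eqP := subr_sqr e f; rewrite e2 f2 subrr eq_sym mulf_eq0 subr_eq0 (negbTE neq_ef) /=.
rewrite addr_eq0 => /eqP ef; have -> : f = - e by rewrite ef opprK.
rewrite mulrN -expr2 e2 scaleN1r scale0r scaleNr.
by rewrite [e *: P + _]addrCA subrr addr0 subrr.
Qed.

Lemma parity_projC e f : parity_proj e * parity_proj f = parity_proj f * parity_proj e.
Proof.
by rewrite /parity_proj !(mulrDl, mulrDr, mul1r, mulr1) !scalemxMl !scalemxMr !scalerA
  [f * e]mulrC -!addrA [e *: P + (f *: P + _)]addrCA.
Qed.

(** The inverse momentum comes from summing over distances: the weight [z ^+ k] at sites [j] and
    [j + k] splits as [z^-1 ^+ j * z ^+ (j + k)]. *)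
Definition mode_pair z : A := mode false z^-1 * mode true z.

Lemma mode_pair_parity z : mode_pair z * P = P * mode_pair z.
Proof.
rewrite /mode_pair -[LHS]mulrA mode_P mulrN [mode false _ * (P * _)]mulrA.
by rewrite mode_P mulNr opprK !mulrA.
Qed.

Lemma mode_pair_proj e z : mode_pair z * parity_proj e = parity_proj e * mode_pair z.
Proof.
by rewrite /parity_proj mulrDl mulrDr mulr1 mul1r scalemxMl scalemxMr mode_pair_parity.
Qed.

Lemma resonanceV z : resonance z^-1 = resonance z.
Proof. by rewrite /resonance invr_eq1. Qed.

(** Bringing both products to the order [false], [false], [true], [true] uses only scalar
    anticommutators, and the quartic terms of the two products cancel. *)
Lemma mode_pair_commutator z w : (z * w) ^+ n = 1 ->
  mode_pair z * mode_pair w - mode_pair w * mode_pair z =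
  resonance (z * w) *: ((resonance (z * w))%:M - mode true z * mode true w
                       - mode false z^-1 * mode false w^-1).
Proof.
move=> zwn; set s := resonance _.
have pairM x y : mode_pair x * mode_pair y =
    - (mode false x^-1 * mode false y^-1 * (mode true x * mode true y)).
  rewrite /mode_pair mulrA -[_ * _ * mode false _]mulrA mode_anticomm_ft.
  by rewrite mulrN mulNr !mulrA.
have tt : mode true w * mode true z = s%:M - mode true z * mode true w.
  by rewrite -(mode_anticomm true zwn) addrC addKr.
have ff : mode false w^-1 * mode false z^-1 = s%:M - mode false z^-1 * mode false w^-1.
  have zwVn : (z^-1 * w^-1) ^+ n = 1 by rewrite -invfM exprVn zwn invr1.
  rewrite /s -resonanceV invfM -(mode_anticomm false zwVn).
  by rewrite addrC addKr.
rewrite !pairM tt ff opprK.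
set u := mode false _ * mode false _; set v := mode true _ * mode true _.
rewrite mulrBl scalar_mulr mulrBr scalar_mull opprB.
by rewrite [in RHS]scalerBr [s *: (_ - _) + _]addrCA addKr.
Qed.

(** The weight of [w] under the pair of [z]: 1 on [z], -1 on [z^-1], 0 elsewhere; if [z ^+ 2 = 1]
    the two indicators cancel. *)
Definition eigen_sign z w : C := (z == w)%:R - (z * w == 1)%:R.

(** The two anticommutators are nonzero only for [w = z] and [w = z^-1], and the mode that each then
    leaves behind is [mode t w] itself. *)
Lemma mode_commutator t z w : z != 0 -> (z * w) ^+ n = 1 -> (z^-1 * w) ^+ n = 1 ->
  mode t z * mode t z^-1 * mode t w - mode t w * (mode t z * mode t z^-1)
  = ((2 * n)%:R * eigen_sign z w) *: mode t w.
Proof.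
move=> z_neq0 zwn zVwn; rewrite commutator_mul_anticomm.
rewrite (mode_anticomm t zwn) (mode_anticomm t zVwn).
rewrite scalar_mull.
rewrite scalar_mulr.
rewrite /eigen_sign.
rewrite mulrBr.
rewrite scalerBl.
congr (_ - _).
  rewrite /resonance -(inj_eq (mulfI z_neq0)) mulVKf // mulr1 eq_sym.
  by case: eqVneq => [->|_]; rewrite ?mulr1 ?mulr0 ?scale0r.
rewrite /resonance; case: eqVneq => [zw1|_]; rewrite ?mulr1 ?mulr0 ?scale0r //.
by congr (_ *: mode t _); apply: (mulfI z_neq0); rewrite mulfV.
Qed.

(** Up to a scalar factor, the quadratic part of the commutator of [mode_pair z] and
    [mode_pair z^-1]; it plays the role of the Cartan element. *)
Definition mode_energy z : A :=
  mode true z * mode true z^-1 + mode false z^-1 * mode false z.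

(** Each half of the energy is an even product, so it passes the factor of the other kind, and it
    scales the factor of its own kind by [2 * n]. In the second half all momenta are inverted, which
    leaves [eigen_sign] unchanged. *)
Lemma mode_energy_commutator z w :
  z != 0 -> w != 0 -> (z * w) ^+ n = 1 -> (z^-1 * w) ^+ n = 1 ->
  mode_energy z * mode_pair w - mode_pair w * mode_energy z
  = ((4 * n)%:R * eigen_sign z w) *: mode_pair w.
Proof.
move=> z_neq0 w_neq0 zwn zVwn; rewrite /mode_energy /mode_pair.
set a := mode true z; set a' := mode true z^-1; set a'' := mode true w.
set b := mode false z^-1; set b' := mode false z; set b'' := mode false w^-1.
have ca : a * a' * a'' - a'' * (a * a') = ((2 * n)%:R * eigen_sign z w) *: a''.
  exact: mode_commutator.
have cb : b * b' * b'' - b'' * (b * b') = ((2 * n)%:R * eigen_sign z w) *: b''.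
  have := @mode_commutator false z^-1 w^-1; rewrite invrK => ->; rewrite ?invr_eq0 //.
  - congr ((_ * _) *: _); rewrite /eigen_sign (inj_eq invr_inj) -invfM invr_eq1.
    by rewrite mulrC.
  - by rewrite -invfM exprVn zwn invr1.
  - by rewrite -[z]invrK -invfM exprVn zVwn invr1.
have e1 : a * a' * (b'' * a'') = b'' * (a * a' * a'').
  by rewrite !mulrA -[a * a' * b'']mulrA mode_anticomm_ft mulrN mulNr mulrA
     mode_anticomm_ft !mulNr opprK.
have e2 : b'' * a'' * (b * b') = b'' * (b * b') * a''.
  rewrite -!mulrA; congr (_ * _).
  by rewrite mulrA mode_anticomm_ft mulNr -mulrA mode_anticomm_ft mulrN opprK mulrA.
rewrite mulrDl mulrDr e1 e2 opprD addrACA [b * b' * (_ * _)]mulrA -[b'' * a'' * (a * a')]mulrA -mulrBr -mulrBl.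
rewrite ca cb scalemxMr scalemxMl -scalerDl; congr (_ *: _).
by rewrite -mulrDl -natrD; congr (_%:R * _); lia.
Qed.

Definition mode_gen z : A := - (parity_proj (- z ^+ n) * mode_pair z).

Lemma mode_gen_commutator z w :
  mode_gen z * mode_gen w - mode_gen w * mode_gen z =
  parity_proj (- z ^+ n) * parity_proj (- w ^+ n) *
  (mode_pair z * mode_pair w - mode_pair w * mode_pair z).
Proof.
have genM x y : mode_gen x * mode_gen y =
    parity_proj (- x ^+ n) * parity_proj (- y ^+ n) * (mode_pair x * mode_pair y).
  rewrite /mode_gen mulrNN -[LHS]mulrA -[RHS]mulrA; congr (_ * _).
  by rewrite [LHS]mulrA mode_pair_proj [RHS]mulrA.
by rewrite !genM [parity_proj (- w ^+ n) * _]parity_projC mulrBr.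
Qed.

(** If [z ^+ n] and [w ^+ n] differ, the projectors are orthogonal. If they agree, then
    [(z * w) ^+ n = 1], so the pair commutator applies, and its factor [resonance (z * w)]
    vanishes. *)
Lemma mode_gen_commute z w : z ^+ (2 * n) = 1 -> w ^+ (2 * n) = 1 -> z * w != 1 ->
  mode_gen z * mode_gen w - mode_gen w * mode_gen z = 0.
Proof.
rewrite mulnC !exprM => z2 w2 neq_zw1; rewrite mode_gen_commutator.
rewrite parity_projM ?sqrrN // eqr_opp.
case: eqP => [eq_zw|_]; last by rewrite scale0r mul0r.
rewrite mode_pair_commutator ?exprMn -?eq_zw -?expr2 //.
by rewrite /resonance (negbTE neq_zw1) scale0r mulr0.
Qed.

(** The constant is [2 * 2 * 2n * 4n]: two products of doubled projectors, the resonance of [z] with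
    [z^-1], and the eigenvalue of the energy, which enters the inner commutator with a minus
    sign. *)
Lemma mode_gen_eigen z w : z ^+ (2 * n) = 1 -> w ^+ (2 * n) = 1 -> z != 0 -> w != 0 ->
  (mode_gen z * mode_gen z^-1 - mode_gen z^-1 * mode_gen z) * mode_gen w
  - mode_gen w * (mode_gen z * mode_gen z^-1 - mode_gen z^-1 * mode_gen z)
  = (- (32 * n ^ 2)%:R * eigen_sign z w) *: mode_gen w.
Proof.
rewrite mulnC !exprM => z2 w2 z_neq0 w_neq0; rewrite mode_gen_commutator.
have zVn : z^-1 ^+ n = z ^+ n.
  by apply: (mulIf (expf_neq0 n z_neq0)); rewrite -exprMn mulVf // expr1n -expr2.
rewrite zVn parity_projM ?sqrrN // eqxx mode_pair_commutator ?mulfV ?expr1n //.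
rewrite /resonance eqxx invrK -addrA -opprD -/(mode_energy z).
set N := (2 * n)%:R; set K := mode_energy z; set Q := parity_proj _.
have QK e : K * parity_proj e = parity_proj e * K.
  have modes_proj t u x y :
      mode t x * mode u y * parity_proj e = parity_proj e * (mode t x * mode u y).
    rewrite /parity_proj mulrDl mulrDr mulr1 mul1r scalemxMl scalemxMr.
    by rewrite -[X in _ + e *: X]mulrA mode_P mulrN [mode t x * (P * _)]mulrA mode_P mulNr opprK !mulrA.
  by rewrite /K /mode_energy [LHS]mulrDl [RHS]mulrDr !modes_proj.
have [D defD] : exists D, D = N%:M - K by exists (N%:M - K).
rewrite -defD; set p := mode_pair w; set Q' := parity_proj (- w ^+ n).
have DQ' : D * Q' = Q' * D by rewrite defD mulrBl [RHS]mulrBr QK scalar_mulr scalar_mull.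
have commQ : Q * D * mode_gen w - mode_gen w * (Q * D) = - (Q * Q' * (D * p - p * D)).
  have -> : mode_gen w = - (Q' * p) by [].
  have pQ : p * Q = Q * p by apply: mode_pair_proj.
  have QQ' : Q * Q' = Q' * Q by apply: parity_projC.
  move: (Q) (Q') (p) DQ' pQ QQ' => q q' r Dq' rq qq'.
  rewrite mulrN mulNr opprK mulrBr opprB addrC; congr (_ - _).
    by rewrite qq' -!mulrA [r * (q * _)]mulrA rq -!mulrA.
  by rewrite !mulrA -[q * D * q']mulrA Dq' !mulrA.
rewrite !scalemxMl !scalemxMr !scalemxMl -!scalerBr !scalerA commQ.
(* In different sectors the left side vanishes by orthogonality, and so does the right side, because
   [w = z] or [w = z^-1] would force equal [n]-th powers. *)
have [eq_zw|neq_zw] := eqVneq (z ^+ n) (w ^+ n); last first.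
  rewrite parity_projM ?sqrrN // eqr_opp (negbTE neq_zw) scale0r mul0r oppr0 scaler0.
  rewrite /eigen_sign; case: (eqVneq z w) neq_zw => [->|_ neq_zw]; first by rewrite eqxx.
  case: eqP => [zw1|_]; last by rewrite subrr mulr0 scale0r.
  by rewrite -zVn (_ : w = z^-1) ?eqxx // in neq_zw; apply: (mulfI z_neq0); rewrite mulfV.
have zwn : (z * w) ^+ n = 1 by rewrite exprMn eq_zw -expr2.
have zVwn : (z^-1 * w) ^+ n = 1 by rewrite exprMn zVn eq_zw -expr2.
have -> : D * p - p * D = - ((4 * n)%:R * eigen_sign z w) *: p.
  rewrite scaleNr -(mode_energy_commutator z_neq0 w_neq0 zwn zVwn) -/K -/p.
  rewrite defD [in LHS]mulrBl [X in _ - X]mulrBr scalar_mulr scalar_mull.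
  by rewrite [in LHS]opprB addrC [in LHS]addrA subrK opprB.
rewrite parity_projM ?sqrrN // eqr_opp eq_zw eqxx !scalemxMr !scalemxMl !scalerA.
have -> : mode_gen w = - (Q * p) by rewrite /Q eq_zw.
rewrite !scalerN scalerA /Q eq_zw; congr (- (_ *: _)).
by rewrite /N !natrM; ring.
Qed.

End MomentumModes.

(** * Pauli strings on the cycle *)

Section PauliStrings.
Variables (R : realType) (n : nat).
Hypothesis n_gt0 : (0 < n)%N.
Local Notation C := R[i].
Local Notation M := 'M[C]_(2 ^ n).
Local Notation X := (@pauliX R n).
Local Notation Y := (@pauliY R n).
Local Notation Z := (@pauliZ R n).
Implicit Types (j k m r s : nat).

Definition zxz_string j k : M := Z j * (\prod_(1 <= s < k) X (j + s)) * Z (j + k).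

(* [zxz k] is [ZX^{k-1}Z] for [0 < k < n], [X^{n-1}] for [k = n], [YX^{2n-k-1}Y] for
   [n < k < 2n] and [-X] for [k = 2n]. *)
Definition zxz k : M := 'i%C *: \sum_(0 <= j < n) zxz_string j k.

Lemma pauliZ_mod j : Z (j %% n) = Z j.
Proof. exact: on_qubit_mod. Qed.

Lemma prodX_sqr (r : seq nat) (f : nat -> nat) :
  (\prod_(s <- r) X (f s)) * (\prod_(s <- r) X (f s)) = 1.
Proof.
elim: r => [|s r IH]; first by rewrite big_nil mulr1.
rewrite big_cons -mulrA [_ * (X _ * _)]mulrA -(@prodX_comm R n r f (f s)) -!mulrA IH mulr1.
exact: pauliX_sqr.
Qed.

Lemma zxz_string_periodic j k : zxz_string (j + n) k = zxz_string j k.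
Proof.
rewrite /zxz_string -pauliZ_mod modnDr pauliZ_mod; congr (_ * _ * _).
  apply: eq_bigr => s _.
  by rewrite -pauliX_mod addnAC modnDr pauliX_mod.
by rewrite -pauliZ_mod addnAC modnDr pauliZ_mod.
Qed.

(** The two strings cancel below site [j]; the first remaining [X] meets [Y] at site [j], and
    [Y X = - i Z]. *)
Lemma majorana_string j k : (j < n)%N -> (0 < k)%N ->
  majorana R n false j * majorana R n true (j + k) = - 'i%C *: zxz_string j k.
Proof.
move=> lt_jn k_gt0; rewrite /majorana /zxz_string.
have -> : jw_string R n (j + k) = jw_string R n j * (X j * \prod_(1 <= s < k) X (j + s)).
  rewrite /jw_string (big_cat_nat (leq0n j) (leq_addr k j)) /=; congr (_ * _).
  rewrite big_nat_shift big_ltn // add0n; congr (_ * _).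
  by apply: eq_bigr => s _; rewrite addnC.
rewrite !mulrA -[_ * _ * jw_string R n j]mulrA (@sigmaZY_jw R n n_gt0 false j j) ?(ltnW lt_jn) //.
rewrite ltnn scale1r mulrA jw_string_sqr mul1r.
rewrite on_qubitM sigma_yx (on_qubitZ n_gt0) !scalemxMl.
by [].
Qed.

Lemma zxz_majorana k : (0 < k)%N ->
  zxz k = - \sum_(0 <= j < n) majorana R n false j * majorana R n true (j + k).
Proof.
move=> k_gt0; rewrite /zxz scaler_sumr -sumrN; apply: eq_big_nat => j /andP[_ lt_jn].
by rewrite majorana_string // scaleNr opprK.
Qed.

Definition zxz_mode (z : C) : M :=
  @mode_gen C (2 ^ n) n (@majorana_mode R n) (parity R n) z.

(** For each site [j] the sum over [k] runs through a full period, so it depends on [j] only through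
    [z^-1 ^+ j]; this decouples the two kinds of Majorana operators. *)
Lemma sum_zxz (z : C) : z ^+ (2 * n) = 1 ->
  \sum_(1 <= k < (2 * n).+1) z ^+ k *: zxz k = zxz_mode z.
Proof.
move=> z2n.
have z_neq0 : z != 0.
  by apply: contra_eq_neq z2n => ->; rewrite expr0n muln_eq0 (gtn_eqF n_gt0) eq_sym oner_neq0.
pose S : M := \sum_(0 <= m < 2 * n) z ^+ m *: majorana R n true m.
have shift2n m : majorana R n true (m + 2 * n) = majorana R n true m.
  by rewrite mul2n -addnn addnA !majorana_shift mulrA parity_sqr mul1r.
have sumk j : \sum_(1 <= k < (2 * n).+1) z ^+ k *: majorana R n true (j + k) = z^-1 ^+ j *: S.
  have zj : z^-1 ^+ j * z ^+ j = 1 by rewrite -exprMn mulVf // expr1n.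
  pose f m := z ^+ m *: majorana R n true m.
  rewrite /S -(@sum_shift_periodic _ (2 * n) j.+1 f); last first.
    by move=> m; rewrite /f shift2n exprD z2n mulr1.
  rewrite scaler_sumr big_add1 /=; apply: eq_bigr => k _.
  rewrite /f scalerA (_ : (k + j.+1 = j + k.+1)%N); last by lia.
  by rewrite exprD mulrA zj mul1r.
have defS : S = majorana_mode n true z + z ^+ n *: (parity R n * majorana_mode n true z).
  rewrite /S mul2n -addnn (big_cat_nat (leq0n n) (leq_addl n n)) /=; congr (_ + _).
  rewrite big_nat_shift /majorana_mode mulr_sumr scaler_sumr.
  apply: eq_bigr => m _; rewrite majorana_shift scalemxMr !scalerA; congr (_ *: _).
  by rewrite exprD mulrC.
transitivity (- (majorana_mode n false z^-1 * S)).
  rewrite /majorana_mode mulr_suml -sumrN.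
  transitivity (\sum_(1 <= k < (2 * n).+1) \sum_(0 <= j < n)
     - (majorana R n false j * (z ^+ k *: majorana R n true (j + k)))).
    apply: eq_big_nat => k /andP[k_gt0 _].
    rewrite zxz_majorana // scalerN scaler_sumr -sumrN; apply: eq_bigr => j _.
    by rewrite scalemxMr.
  rewrite exchange_big /=; apply: eq_bigr => j _.
  by rewrite sumrN -mulr_sumr sumk scalemxMl scalemxMr.
(* Moving [P] to the left of the [false] mode changes the sign of [z ^+ n]. *)
rewrite defS /zxz_mode /mode_gen /mode_pair /parity_proj.
move: (majorana_mode n true z) (@parity_mode R n n_gt0 false z^-1).
move: (majorana_mode n false z^-1) (parity R n) => b P a bP.
rewrite mulrDr mulrDl mul1r; congr (- (_ + _)).
by rewrite scalemxMr scalemxMl mulrA bP mulNr scalerN scaleNr mulrA.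
Qed.


Lemma zxz_mode_commute (z w : C) :
  z ^+ (2 * n) = 1 -> w ^+ (2 * n) = 1 -> z * w != 1 ->
  bracket (zxz_mode z) (zxz_mode w) = 0.
Proof.
apply: mode_gen_commute => [x y|t x y xyn||t x].
- by apply/eqP; rewrite -addr_eq0 majorana_mode_anticomm // mulr0 scalar_mx0.
- rewrite majorana_mode_anticomm // sum_unity_powers // eqxx /resonance.
  by case: (x * y == 1); rewrite ?mul0r // -natrM mulnC.
- exact: parity_sqr.
- exact: parity_mode.
Qed.

Lemma zxz_mode_eigen (z w : C) :
  z ^+ (2 * n) = 1 -> w ^+ (2 * n) = 1 -> z != 0 -> w != 0 ->
  bracket (bracket (zxz_mode z) (zxz_mode z^-1)) (zxz_mode w)
  = (- (32 * n ^ 2)%:R * ((z == w)%:R - (z * w == 1)%:R)) *: zxz_mode w.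
Proof.
apply: mode_gen_eigen => [x y|t x y xyn||t x].
- by apply/eqP; rewrite -addr_eq0 majorana_mode_anticomm // mulr0 scalar_mx0.
- rewrite majorana_mode_anticomm // sum_unity_powers // eqxx /resonance.
  by case: (x * y == 1); rewrite ?mul0r // -natrM mulnC.
- exact: parity_sqr.
- exact: parity_mode.
Qed.

Lemma sumZXZ_zxz t : sumZXZ R n t = zxz t.+1.
Proof. by []. Qed.

Lemma sumZZ_zxz : sumZZ R n = zxz 1.
Proof.
congr (_ *: _); apply: eq_bigr => j _.
by rewrite /zxz_string big_geq // mulr1 addn1.
Qed.

(** Two turns meet every site twice. A string longer than one turn can thus be traded for its
    complement. *)
Lemma prod_full_cycle j : \prod_(0 <= s < 2 * n) X (j + s) = 1.
Proof.
rewrite mul2n -addnn (big_cat_nat (leq0n n) (leq_addl n n)) /= big_nat_shift.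
rewrite -[RHS](prodX_sqr (index_iota 0 n) (addn j)); congr (_ * _).
by apply: eq_bigr => s _; rewrite -pauliX_mod addnA modnDr pauliX_mod.
Qed.

Lemma zxz_sumX : zxz (2 * n) = - sumX R n.
Proof.
rewrite /zxz /sumX -scalerN -sumrN; congr (_ *: _); apply: eq_bigr => j _.
have /esym := prod_full_cycle j; rewrite big_ltn ?muln_gt0 // addn0 => prodE.
have prodE1 : \prod_(1 <= s < 2 * n) X (j + s) = X j.
  by rewrite -[RHS]mulr1 [X in _ = _ * X]prodE mulrA pauliX_sqr mul1r.
have -> : zxz_string j (2 * n) = Z j * X j * Z j.
  rewrite /zxz_string prodE1 -[Z (j + _)]pauliZ_mod.
  by rewrite mul2n -addnn addnA !modnDr pauliZ_mod.
rewrite !on_qubitM sigma_zx scalemxMl sigma_yz scalerA -expr2 sqr_i on_qubitZ //.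
by rewrite scaleN1r.
Qed.

(** After one turn the two end factors sit on the same site and cancel; the interior starts at
    [j + 1], hence the shift of the summation by one. *)
Lemma zxz_sumXn1 : zxz n = sumXn1 R n.
Proof.
congr (_ *: _).
rewrite -(@sum_shift_periodic _ n 1 (fun j => \prod_(0 <= s < n.-1) X (j + s))); last first.
  by move=> k; apply: eq_bigr => s _; rewrite -pauliX_mod addnAC modnDr pauliX_mod.
apply: eq_bigr => j _; rewrite /zxz_string -[Z (j + n)]pauliZ_mod modnDr pauliZ_mod.
have comZ : GRing.comm (Z j) (\prod_(1 <= s < n) X (j + s)).
  rewrite big_nat; apply: commr_prod => s /andP[s_gt0 lt_sn]; apply: on_qubit_comm.
  by rewrite -[X in X != _ %[mod _]]addn0 eqn_modDl mod0n modn_small // eq_sym -lt0n.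
rewrite comZ -mulrA /pauliZ on_qubitM sigma_zz on_qubit1 mulr1.
by rewrite big_add1; apply: eq_bigr => s _; rewrite addn1 addnS addSn.
Qed.

(** The long interior equals the complementary short one with an additional [X] at each end, and
    these turn the end factors [Z] into [Y]. The sum is shifted by [k] so that the short string
    starts at [j]. *)
Lemma zxz_sumYXY k : (0 < k < n)%N -> zxz (2 * n - k) = sumYXY R n k.-1.
Proof.
case/andP=> k_gt0 lt_kn; congr (_ *: _).
rewrite -(@sum_shift_periodic _ n k (fun j => zxz_string j (2 * n - k))); last first.
  by move=> j; apply: zxz_string_periodic.
apply: eq_bigr => j _; rewrite prednK // /zxz_string.
have -> : Z (j + k + (2 * n - k)) = Z j.
  rewrite (_ : j + k + _ = j + n + n)%N; last by lia.
  by rewrite -pauliZ_mod !modnDr pauliZ_mod.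
set p := \prod_(1 <= s < k) X (j + s); set q := \prod_(1 <= s < _) X (j + k + s).
have neq_jk : j + k != j %[mod n].
  by rewrite -[X in _ != X %[mod _]]addn0 eqn_modDl mod0n modn_small // -lt0n.
have comYp : GRing.comm (Y j) p.
  rewrite /p big_nat; apply: commr_prod => s /andP[s_gt0 lt_sk]; apply: on_qubit_comm.
  rewrite -[X in X != _ %[mod _]]addn0 eqn_modDl mod0n modn_small ?(ltn_trans lt_sk) //.
  by rewrite eq_sym -lt0n.
have comYkp : GRing.comm (Y (j + k)) p.
  rewrite /p big_nat; apply: commr_prod => s /andP[s_gt0 lt_sk]; apply: on_qubit_comm.
  rewrite eqn_modDl !modn_small ?(ltn_trans lt_sk) //.
  by rewrite gtn_eqF.
have qE : q = X (j + k) * p * X j.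
  have := prod_full_cycle j.
  rewrite big_ltn ?muln_gt0 // addn0 (@big_cat_nat _ _ _ k) ?(leq_trans (ltnW lt_kn)) //=;
    last by rewrite leq_pmull.
  rewrite -/p [X in _ * (_ * X)]big_ltn; last by lia.
  have -> : \prod_(k.+1 <= s < 2 * n) X (j + s) = q.
    rewrite (_ : 2 * n = k.+1 + (2 * n - k).-1)%N; last by lia.
    rewrite big_nat_shift /q big_add1 /=; apply: eq_bigr => s _; congr X; lia.
  have pp : p * p = 1 by apply: prodX_sqr.
  have := pauliX_sqr R n j; have := pauliX_sqr R n (j + k).
  have : X j * p = p * X j by apply: prodX_comm.
  have : X (j + k) * p = p * X (j + k) by apply: prodX_comm.
  move: (X j) (X (j + k)) (p) (q) pp => x y p' q' pp yp xp yy xx full.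
  by rewrite -[RHS]mulr1 -full !mulrA -[y * p' * x * x]mulrA xx mulr1
     -[y * p' * p']mulrA pp mulr1 yy mul1r.
rewrite qE -!mulrA [X j * _]on_qubitM sigma_xz [Z (j + k) * _]mulrA on_qubitM sigma_zx.
rewrite !on_qubitZ // -/(pauliY R n j) -/(pauliY R n (j + k)).
rewrite scalemxMl !scalemxMr scalerA mulrN -expr2 sqr_i opprK scale1r.
rewrite mulrA comYkp -mulrA on_qubit_comm // mulrA comYp.
by rewrite !mulrA.
Qed.

End PauliStrings.

(** * Nonvanishing of the Fourier sums *)

Section VacuumEntry.
Variables (R : realType) (n : nat).
Hypothesis n_gt0 : (0 < n)%N.
Local Notation C := R[i].
Local Notation M := 'M[C]_(2 ^ n).
Local Notation X := (@pauliX R n).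
Local Notation Z := (@pauliZ R n).
Implicit Types (j k r s : nat).

(** The basis state with all digits 0, fixed by every [Z]. An operator that anticommutes with some
    [Z] has diagonal entry 0 there. *)
Definition vacuum : 'I_(2 ^ n) := Ordinal (expn_gt0 2 n).

Lemma pauliZ_offdiag j (a b : 'I_(2 ^ n)) : a != b -> Z j a b = 0.
Proof.
move=> neq_ab; rewrite mxE.
case: (pickP (fun k : 'I_n => qubit_bit k a != qubit_bit k b)) => [k nk|eqk].
  by rewrite (bigD1 k) //=; case: ifP => _; rewrite mxE ?nk ?(negbTE nk) mul0r.
case/eqP: neq_ab; apply: qubit_bit_inj => k.
by apply/eqP/negbNE; rewrite eqk.
Qed.

Lemma pauliZ_vacuum j : Z j vacuum vacuum = 1.
Proof.
rewrite mxE big1 // => k _.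
have -> : qubit_bit k vacuum = 0.
  by apply: val_inj; rewrite /qubit_bit div0n mod0n /= inordK.
by case: ifP => _; rewrite mxE.
Qed.

Lemma pauliZ_mull j (u : M) : (Z j * u) vacuum vacuum = u vacuum vacuum.
Proof.
rewrite mxE (bigD1 vacuum) //= pauliZ_vacuum mul1r big1 ?addr0 // => a neq_a.
by rewrite pauliZ_offdiag ?mul0r // eq_sym.
Qed.

Lemma pauliZ_mulr j (u : M) : (u * Z j) vacuum vacuum = u vacuum vacuum.
Proof.
rewrite mxE (bigD1 vacuum) //= pauliZ_vacuum mulr1 big1 ?addr0 // => a neq_a.
by rewrite pauliZ_offdiag ?mulr0.
Qed.

Lemma pauliZ_comm i j : GRing.comm (Z i) (Z j).
Proof.
have [eq_ij|neq_ij] := eqVneq (i %% n)%N (j %% n)%N; last exact: on_qubit_comm.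
by rewrite /GRing.comm -pauliZ_mod eq_ij pauliZ_mod.
Qed.

(* Some site carries an odd number of the factors [X]. *)
Lemma zxz_string_anticomm j k : (1 < k <= 2 * n)%N ->
  exists r, Z r * zxz_string R n j k = - (zxz_string R n j k * Z r).
Proof.
case/andP=> k_gt1 le_k2n.
(* Up to length [n.+1] the interior sites are distinct, so [j + 1] serves. In longer strings the
   second turn repeats that site, but site [j] is met only at offset [n], as offsets 0 and [2 * n]
   lie outside the interior. *)
pose s0 := if (k <= n.+1)%N then 1%N else n.
have s0P : (1 <= s0 < k)%N by rewrite /s0; case: ifP => ?; lia.
case/andP: s0P => s0_gt0 lt_s0k.
exists (j + s0)%N.
have comZX (s : nat) : (1 <= s < k)%N -> s != s0 -> GRing.comm (Z (j + s0)) (X (j + s)).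
  move=> s_lek neq_s; apply: on_qubit_comm; rewrite eqn_modDl.
  apply: contraNneq neq_s => /eqP.
  have [le_ss0|lt_s0s] := leqP s s0.
    rewrite eqn_mod_dvd // => /dvdnP[q]; move: le_ss0 s_lek.
    by rewrite /s0; case: ifP => _; case: q => [|q]; rewrite ?mulSn; lia.
  rewrite eq_sym eqn_mod_dvd 1?ltnW // => /dvdnP[q]; move: lt_s0s s_lek.
  by rewrite /s0; case: ifP => ?; case: q => [|q]; rewrite ?mulSn; lia.
rewrite /zxz_string (@big_cat_nat _ _ _ s0) ?(ltnW lt_s0k) //= [X in _ * (_ * X) * _]big_ltn //.
set p := \prod_(1 <= s < s0) _; set q := \prod_(s0.+1 <= s < k) _.
have comp : GRing.comm (Z (j + s0)) p.
  rewrite /p big_nat; apply: commr_prod => s /andP[s_gt0 lt_s]; apply: comZX.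
    by rewrite s_gt0 (ltn_trans lt_s).
  by rewrite ltn_eqF.
have comq : GRing.comm (Z (j + s0)) q.
  rewrite /q big_nat; apply: commr_prod => s /andP[s_gt lt_s]; apply: comZX.
    by rewrite lt_s (leq_trans _ s_gt).
  by rewrite gtn_eqF.
have antiX : Z (j + s0) * X (j + s0) = - (X (j + s0) * Z (j + s0)).
  by rewrite !on_qubitM sigma_zx sigma_xz scaleNr on_qubitN // opprK.
have := pauliZ_comm (j + s0) j; have := pauliZ_comm (j + s0) (j + k).
move: antiX comp comq; rewrite /GRing.comm.
move: (Z (j + s0)) (X (j + s0)) (Z j) (Z (j + k)) (p) (q) => z x a b p' q' zx zp zq zb za.
rewrite !mulrA za -[a * z * p']mulrA zp -!mulrA [z * (x * _)]mulrA zx mulNr !mulrN.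
by rewrite -[x * z * _]mulrA [z * (q' * _)]mulrA zq -mulrA zb !mulrA.
Qed.

Lemma zxz_vacuum k : (1 < k <= 2 * n)%N -> zxz R n k vacuum vacuum = 0.
Proof.
move=> k_bd; rewrite mxE summxE big1 ?mulr0 // => j _.
have [r] := zxz_string_anticomm j k_bd; move: (zxz_string R n j k) => u.
move=> /matrixP/(_ vacuum vacuum); rewrite pauliZ_mull [in RHS]mxE pauliZ_mulr => /eqP.
by rewrite eq_sym eqNr => /eqP.
Qed.

Lemma zxz1_vacuum : zxz R n 1 vacuum vacuum = 'i%C * n%:R.
Proof.
rewrite mxE summxE; congr (_ * _).
rewrite -[n in RHS]subn0 -sumr_const_nat; apply: eq_bigr => j _.
by rewrite /zxz_string big_geq // mulr1 pauliZ_mull pauliZ_vacuum.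
Qed.

(** In the Fourier sum only [k = 1] contributes to the vacuum entry, which is therefore
    [z * ('i * n)]. *)
Lemma zxz_mode_neq0 (z : C) : z ^+ (2 * n) = 1 -> zxz_mode n z != 0.
Proof.
move=> z2n; have z_neq0 : z != 0.
  by apply: contra_eq_neq z2n => ->; rewrite expr0n muln_eq0 (gtn_eqF n_gt0) eq_sym oner_neq0.
apply/eqP => /matrixP/(_ vacuum vacuum)/eqP.
rewrite -sum_zxz // summxE big_ltn ?ltnS ?muln_gt0 // big_nat big1 => [|k /andP[k_gt1 lt_k]].
  rewrite addr0 [X in X == _]mxE [X in _ == X]mxE zxz1_vacuum expr1 !mulf_eq0 (negbTE z_neq0).
  by rewrite pnatr_eq0 (gtn_eqF n_gt0) complexiE (negbTE (neq0Ci _)).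
by rewrite mxE zxz_vacuum ?mulr0 // k_gt1.
Qed.

End VacuumEntry.

Section ParitySums.
Variable V : nmodType.
Implicit Types (f : nat -> V) (n : nat).

Lemma sum_even f n :
  \sum_(1 <= k < n | ~~ odd k) f k = \sum_(1 <= t < (n.-1)./2.+1) f (2 * t)%N.
Proof.
elim: n => [|[|n] IH]; [by rewrite !big_geq | by rewrite !big_geq |].
rewrite (@big_cat_nat _ _ _ n.+1) //= IH big_ltn_cond // [in X in _ + X]big_geq // addr0.
rewrite /= uphalf_half negbK; case n_odd: (odd n); rewrite /= ?addr0 // add1n.
by rewrite [RHS]big_nat_recr //=; congr (_ + f _); lia.
Qed.

Lemma sum_odd f n :
  \sum_(1 <= k < n | odd k) f k = \sum_(0 <= t < n./2) f (2 * t).+1.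
Proof.
elim: n => [|[|n] IH]; [by rewrite !big_geq | by rewrite !big_geq |].
rewrite (@big_cat_nat _ _ _ n.+1) //= IH big_ltn_cond // [in X in _ + X]big_geq // addr0.
rewrite /= uphalf_half; case n_odd: (odd n); rewrite /= ?addr0 // add0n.
by rewrite [RHS]big_nat_recr //=; congr (_ + f _); lia.
Qed.

End ParitySums.

(** * Lie algebras spanned by su(2)-triples *)

Lemma scaler_cross (K : comPzRingType) (V : lmodType K) (e f t : V) (a b d a' b' d' : K) :
  a *: (b' *: t - d' *: f) + b *: (d' *: e - a' *: t) + d *: (a' *: f - b' *: e)
  = (b * d' - d * b') *: e + (d * a' - a * d') *: f + (a * b' - b * a') *: t.
Proof.
rewrite !scalerBr !scalerA !scalerBl.
by rewrite [LHS](AC (2 * 2 * 2) ((3 * 6) * (5 * 2) * (1 * 4))).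
Qed.

Section Bracket.
Variables (R : realType) (m : nat).
Local Notation C := R[i].
Local Notation M := 'M[C]_m.
Implicit Types (A B D : M) (c d : C).

Lemma bracketDl A B D : bracket (A + B) D = bracket A D + bracket B D.
Proof. by rewrite /bracket mulrDl mulrDr opprD addrACA. Qed.

Lemma bracketDr A B D : bracket D (A + B) = bracket D A + bracket D B.
Proof. by rewrite /bracket mulrDl mulrDr opprD addrACA. Qed.

Lemma bracketZl c A B : bracket (c *: A) B = c *: bracket A B.
Proof. by rewrite /bracket scalemxMl scalemxMr scalerBr. Qed.

Lemma bracketZr c A B : bracket A (c *: B) = c *: bracket A B.
Proof. by rewrite /bracket scalemxMl scalemxMr scalerBr. Qed.

Lemma bracketC A B : bracket A B = - bracket B A.
Proof. by rewrite /bracket opprB. Qed.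

Lemma bracketxx A : bracket A A = 0.
Proof. by rewrite /bracket subrr. Qed.

Lemma bracket0l A : bracket 0 A = 0.
Proof. by rewrite /bracket mul0r mulr0 subrr. Qed.

Lemma bracket0r A : bracket A 0 = 0.
Proof. by rewrite /bracket mul0r mulr0 subrr. Qed.

Lemma bracketNr A B : bracket A (- B) = - bracket A B.
Proof. by rewrite -scaleN1r bracketZr scaleN1r. Qed.

Lemma bracket_suml (I : Type) (r : seq I) (F : I -> M) B :
  bracket (\sum_(i <- r) F i) B = \sum_(i <- r) bracket (F i) B.
Proof.
by elim/big_rec2: _ => [|i y1 y2 _ <-]; rewrite ?bracket0l ?bracketDl.
Qed.

Lemma bracket_sumr (I : Type) (r : seq I) (F : I -> M) B :
  bracket B (\sum_(i <- r) F i) = \sum_(i <- r) bracket B (F i).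
Proof.
by elim/big_rec2: _ => [|i y1 y2 _ <-]; rewrite ?bracket0r ?bracketDr.
Qed.

Lemma real_subspace_sum (V : set M) (I : Type) (r : seq I) (P : pred I) (F : I -> M) :
  real_subspace V -> (forall i, P i -> V (F i)) -> V (\sum_(i <- r | P i) F i).
Proof. by case=> V0 VD _ VF; apply: big_ind => // A B; apply: VD. Qed.

Lemma real_subspaceN (V : set M) A : real_subspace V -> V A -> V (- A).
Proof. by case=> _ _ VZ VA; have := VZ (-1) _ VA; rewrite rmorphN1 scaleN1r. Qed.

Lemma real_subspaceB (V : set M) A B : real_subspace V -> V A -> V B -> V (A - B).
Proof. by move=> HV VA VB; case: (HV) => _ VD _; apply: VD => //; apply: real_subspaceN. Qed.

Lemma real_span2_subspace A B : real_subspace (real_span2 A B).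
Proof.
split=> [|_ _ [a [b ->]] [a' [b' ->]]|a _ [b [d ->]]].
- by exists 0, 0; rewrite !scale0r addr0.
- by exists (a + a'), (b + b'); rewrite !rmorphD !scalerDl addrACA.
- by exists (a * b), (a * d); rewrite !rmorphM scalerDr !scalerA.
Qed.

Definition real_span3 A B D : set M :=
  [set x | exists a b d : R, x = a%:C%C *: A + b%:C%C *: B + d%:C%C *: D].

Lemma real_span3_comb A B D (a b d : R) :
  real_span3 A B D (a%:C%C *: A + b%:C%C *: B + d%:C%C *: D).
Proof. by exists a, b, d. Qed.

Lemma comb3D A B D (a b d a' b' d' : R) :
  (a%:C%C *: A + b%:C%C *: B + d%:C%C *: D) + (a'%:C%C *: A + b'%:C%C *: B + d'%:C%C *: D)
  = (a + a')%:C%C *: A + (b + b')%:C%C *: B + (d + d')%:C%C *: D.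
Proof. by rewrite !rmorphD !scalerDl addrACA [X in X + _]addrACA. Qed.

Lemma comb3B A B D (a b d a' b' d' : R) :
  (a%:C%C *: A + b%:C%C *: B + d%:C%C *: D) - (a'%:C%C *: A + b'%:C%C *: B + d'%:C%C *: D)
  = (a - a')%:C%C *: A + (b - b')%:C%C *: B + (d - d')%:C%C *: D.
Proof. by rewrite !rmorphB !scalerBl !opprD addrACA [X in X + _]addrACA. Qed.

Lemma comb3Z A B D (k a b d : R) :
  k%:C%C *: (a%:C%C *: A + b%:C%C *: B + d%:C%C *: D)
  = (k * a)%:C%C *: A + (k * b)%:C%C *: B + (k * d)%:C%C *: D.
Proof. by rewrite !rmorphM !scalerDr !scalerA. Qed.

Lemma real_span3_subspace A B D : real_subspace (real_span3 A B D).
Proof.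
split=> [|_ _ [a [b [d ->]]] [a' [b' [d' ->]]]|k _ [a [b [d ->]]]].
- by exists 0, 0, 0; rewrite !scale0r !addr0.
- by rewrite comb3D; apply: real_span3_comb.
- by rewrite comb3Z; apply: real_span3_comb.
Qed.

(** The cross product relations of three-space. With one element nonzero, they force all three to be
    nonzero and linearly independent. *)
Definition su2_triple A B D :=
  [/\ bracket A B = D, bracket B D = A, bracket D A = B & A != 0].

Section Triple.
Variables e f t : M.
Hypothesis eft : su2_triple e f t.

Let ef : bracket e f = t. Proof. by case: eft. Qed.
Let ft : bracket f t = e. Proof. by case: eft. Qed.
Let te : bracket t e = f. Proof. by case: eft. Qed.
Let fe : bracket f e = - t. Proof. by rewrite bracketC ef. Qed.
Let tf : bracket t f = - e. Proof. by rewrite bracketC ft. Qed.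
Let et : bracket e t = - f. Proof. by rewrite bracketC te. Qed.

Lemma bracket_comb3l (a b d : C) x :
  bracket (a *: e + b *: f + d *: t) x = a *: bracket e x + b *: bracket f x + d *: bracket t x.
Proof. by rewrite !bracketDl !bracketZl. Qed.

Lemma bracket_comb3r (a b d : C) x :
  bracket x (a *: e + b *: f + d *: t) = a *: bracket x e + b *: bracket x f + d *: bracket x t.
Proof. by rewrite !bracketDr !bracketZr. Qed.

Lemma bracket_comb3 (a b d a' b' d' : R) :
  bracket (a%:C%C *: e + b%:C%C *: f + d%:C%C *: t) (a'%:C%C *: e + b'%:C%C *: f + d'%:C%C *: t)
  = (b * d' - d * b')%:C%C *: e + (d * a' - a * d')%:C%C *: f + (a * b' - b * a')%:C%C *: t.
Proof.
have cross (x y z w : R) : (x * y - z * w)%:C%C = x%:C%C * y%:C%C - z%:C%C * w%:C%C.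
  by rewrite rmorphB !rmorphM.
rewrite !cross -scaler_cross bracket_comb3l.
move: (a'%:C%C) (b'%:C%C) (d'%:C%C) => x y z.
have -> : bracket e (x *: e + y *: f + z *: t) = y *: t - z *: f.
  by rewrite bracket_comb3r bracketxx ef et scaler0 add0r scalerN.
have -> : bracket f (x *: e + y *: f + z *: t) = z *: e - x *: t.
  by rewrite bracket_comb3r bracketxx fe ft scaler0 addr0 scalerN addrC.
have -> // : bracket t (x *: e + y *: f + z *: t) = x *: f - y *: e.
by rewrite bracket_comb3r bracketxx te tf scaler0 addr0 scalerN.
Qed.

Lemma real_span3_lie : lie_subalgebra (real_span3 e f t).
Proof.
split; first exact: real_span3_subspace.
move=> _ _ [a [b [d ->]]] [a' [b' [d' ->]]].
by rewrite bracket_comb3; apply: real_span3_comb.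
Qed.

Lemma comb3_central (a b d : R) :
  let x := a%:C%C *: e + b%:C%C *: f + d%:C%C *: t in
  bracket x e = 0 -> bracket x f = 0 -> [/\ a = 0, b = 0 & d = 0].
Proof.
have e_neq0 : e != 0 by case: eft.
have f_neq0 : f != 0.
  by apply: contraNneq e_neq0 => f0; rewrite -ft f0 bracket0l.
move=> x; rewrite {}/x !bracket_comb3l !bracketxx fe te ef tf => be bf.
have {}be : d%:C%C *: f = b%:C%C *: t.
  by apply/eqP; rewrite -subr_eq0 addrC -scalerN -be scaler0 add0r.
have {}bf : a%:C%C *: t = d%:C%C *: e.
  by apply/eqP; rewrite -subr_eq0 -scalerN -bf scaler0 addr0.
have zero_coef (y : C) A : A != 0 -> y *: A = 0 -> y = 0.
  by move=> A_neq0 /eqP; rewrite scaler_eq0 (negbTE A_neq0) orbF => /eqP.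
have b0 : b%:C%C = 0 :> C.
  by apply: (zero_coef _ _ e_neq0); rewrite -ft -bracketZr -be bracketZr bracketxx scaler0.
have d0 : d%:C%C = 0 :> C by apply: (zero_coef _ _ f_neq0); rewrite be b0 scale0r.
have a0 : a%:C%C = 0 :> C.
  by apply: (zero_coef _ _ f_neq0); rewrite -te -bracketZl bf d0 scale0r bracket0l.
by split; apply: complexI.
Qed.

Lemma real_span3_centerless x :
  real_span3 e f t x -> (forall y, real_span3 e f t y -> bracket x y = 0) -> x = 0.
Proof.
case=> [a [b [d ->]]] central.
have [||-> -> ->] := @comb3_central a b d; last by rewrite !scale0r !addr0.
- by apply: central; exists 1, 0, 0; rewrite !scale0r !addr0 scale1r.
- by apply: central; exists 0, 1, 0; rewrite !scale0r addr0 add0r scale1r.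
Qed.

(** The difference of the two combinations is 0, hence central, so [comb3_central] yields uniqueness
    of coordinates. *)
Lemma comb3_inj (a b d a' b' d' : R) :
  a%:C%C *: e + b%:C%C *: f + d%:C%C *: t = a'%:C%C *: e + b'%:C%C *: f + d'%:C%C *: t ->
  [/\ a = a', b = b' & d = d'].
Proof.
move=> eq_comb.
have br0 x : bracket ((a - a')%:C%C *: e + (b - b')%:C%C *: f + (d - d')%:C%C *: t) x = 0.
  by rewrite -comb3B eq_comb subrr bracket0l.
have [a0 b0 d0] := comb3_central (br0 e) (br0 f).
by split; apply: subr0_eq.
Qed.

End Triple.

Definition commuting_sum (I : finType) (V : I -> set M) : set M :=
  [set A | exists2 B : I -> M, forall k, V k (B k) & A = \sum_k B k].

Section DirectSum.
Variables (k : nat) (c : set M) (g : 'I_k -> set M).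
Let V (o : option 'I_k) : set M := if o is Some j then g j else c.
Hypothesis V_lie : forall o, lie_subalgebra (V o).
Hypothesis V_comm : forall o o', o != o' -> forall A B, V o A -> V o' B -> bracket A B = 0.
Hypothesis c_abelian : forall A B, c A -> c B -> bracket A B = 0.
Hypothesis g_centerless : forall j A, g j A -> (forall B, g j B -> bracket A B = 0) -> A = 0.

(** Bracketing with elements of one component replaces the projection onto it, which exists only
    once the sum is known to be direct. *)
Lemma bracket_component (B : option 'I_k -> M) (o : option 'I_k) (A : M) :
  (forall o', V o' (B o')) -> V o A -> bracket (\sum_o' B o') A = bracket (B o) A.
Proof.
move=> VB VA; rewrite bracket_suml (bigD1 o) //= big1 ?addr0 // => o' neq_o.
exact: (V_comm neq_o).
Qed.

Lemma commuting_sum_lie : lie_subalgebra (commuting_sum V).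
Proof.
split; first split.
- exists (fun=> 0); last by rewrite big1.
  by move=> o; have [[]] := V_lie o.
- move=> _ _ [B VB ->] [B' VB' ->]; exists (fun o => B o + B' o); last by rewrite big_split.
  by move=> o; have [[_ VD _] _] := V_lie o; apply: VD.
- move=> a _ [B VB ->]; exists (fun o => a%:C%C *: B o); last by rewrite scaler_sumr.
  by move=> o; have [[_ _ VZ] _] := V_lie o; apply: VZ.
move=> _ _ [B VB ->] [B' VB' ->]; exists (fun o => bracket (B o) (B' o)).
  by move=> o; have [_] := V_lie o; apply.
by rewrite bracket_sumr; apply: eq_bigr => o _; apply: bracket_component.
Qed.

Lemma commuting_sum_component o A : V o A -> commuting_sum V A.
Proof.
move=> VA; exists (fun o' => if o' == o then A else 0).
  by move=> o'; case: eqP => [->|_] //; have [[]] := V_lie o'.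
by rewrite (bigD1 o) //= eqxx big1 ?addr0 // => o' /negbTE ->.
Qed.

(** The differences of the terms sum to 0; bracketing with [g j] shows that the [j]-th difference is
    central in [g j], hence 0, and then the one in [c] is 0 as well. *)
Lemma commuting_sum_direct : lie_direct_sum (commuting_sum V) V.
Proof.
split=> // B B' VB VB' eq_sum.
have VD o : V o (B o - B' o) by have [HV _] := V_lie o; apply: real_subspaceB.
have sumD : \sum_o (B o - B' o) = 0 by rewrite sumrB eq_sum subrr.
have D_some j : B (Some j) - B' (Some j) = 0.
  apply: (@g_centerless j); first exact: (VD (Some j)).
  by move=> A gA; rewrite -(@bracket_component (fun o => B o - B' o) (Some j)) // sumD bracket0l.
case=> [j|]; first exact/subr0_eq/D_some.
apply: subr0_eq; rewrite -sumD (bigD1 None) //= big1 ?addr0 //.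
by case=> // j _.
Qed.

Lemma commuting_sum_center : c = lie_center (commuting_sum V).
Proof.
apply/seteqP; split=> A.
  move=> cA; split; first exact: (@commuting_sum_component None).
  move=> _ [B VB ->]; rewrite bracketC (@bracket_component B None) //.
  by rewrite c_abelian ?oppr0 //; apply: (VB None).
case=> -[B VB ->] central; rewrite (bigD1 None) //= big1 ?addr0; first exact: (VB None).
case=> // j _; apply: (@g_centerless j); first exact: (VB (Some j)).
move=> D gD; rewrite -(@bracket_component B (Some j)) //; apply: central.
exact: (@commuting_sum_component (Some j)).
Qed.

End DirectSum.

End Bracket.

Lemma su2_triple_isomorphic (R : realType) m p (e f t : 'M[R[i]]_m) (e' f' t' : 'M[R[i]]_p) :
  su2_triple e f t -> su2_triple e' f' t' ->
  lie_isomorphic (real_span3 e f t) (real_span3 e' f' t').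
Proof.
move=> T T'.
pose Q (A : 'M[R[i]]_m) (B : 'M[R[i]]_p) := exists a b d : R,
  A = a%:C%C *: e + b%:C%C *: f + d%:C%C *: t /\
  B = a%:C%C *: e' + b%:C%C *: f' + d%:C%C *: t'.
(* Choice turns equality of coordinates into a function on all matrices; off the span its values are
   arbitrary. *)
have /boolp.choice[h hQ] : forall A, exists B, real_span3 e f t A -> Q A B.
  move=> A; have [[a [b [d ->]]]|nA] := boolp.pselect (real_span3 e f t A); last by exists 0.
  by exists (a%:C%C *: e' + b%:C%C *: f' + d%:C%C *: t'); exists a, b, d.
have hE a b d : h (a%:C%C *: e + b%:C%C *: f + d%:C%C *: t) =
    a%:C%C *: e' + b%:C%C *: f' + d%:C%C *: t'.
  have [a' [b' [d' [/(comb3_inj T)[<- <- <-] ->]]]] := hQ _ (real_span3_comb e f t a b d).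
  by [].
exists h; split.
- split.
  + by move=> _ [a [b [d ->]]] /=; rewrite hE; apply: real_span3_comb.
  + move=> _ _ /set_mem[a [b [d ->]]] /set_mem[a' [b' [d' ->]]].
    by rewrite !hE => /(comb3_inj T')[-> -> ->].
  + move=> _ [a [b [d ->]]]; exists (a%:C%C *: e + b%:C%C *: f + d%:C%C *: t) => //.
    exact: real_span3_comb.
- move=> _ _ [a [b [d ->]]] [a' [b' [d' ->]]].
  by rewrite comb3D !hE comb3D.
- by move=> k _ [a [b [d ->]]]; rewrite comb3Z !hE comb3Z.
- move=> _ _ [a [b [d ->]]] [a' [b' [d' ->]]].
  by rewrite (bracket_comb3 T) !hE (bracket_comb3 T').
Qed.

(** * A basis of su(2) *)

Section SpecialUnitary.
Variable R : realType.
Local Notation C := R[i].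

(** The scalar [c = - i / 2]: as [[X, Y] = 2 i Z] for the Pauli matrices, the multiples by a nonzero
    [c] satisfy the cross product relations when [2 i c = 1]. *)
Definition half_i : C := Complex 0 (- (1 / 2%:R)).
Definition su2_x : 'M[C]_2 := half_i *: sigma_x R.
Definition su2_y : 'M[C]_2 := half_i *: sigma_y R.
Definition su2_z : 'M[C]_2 := half_i *: sigma_z R.

Lemma half_i_sqr : half_i * half_i * 2%:R * 'i%C = half_i.
Proof. by apply/eqP; rewrite eq_complex /=; apply/andP; split; apply/eqP; field. Qed.

Lemma su2_basis_triple : su2_triple su2_x su2_y su2_z.
Proof.
have br (A B D : 'M[C]_2) : A * B = 'i%C *: D -> B * A = - 'i%C *: D ->
    bracket (half_i *: A) (half_i *: B) = half_i *: D.
  move=> AB BA; rewrite bracketZl bracketZr /bracket AB BA scaleNr opprK -mulr2n.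
  by rewrite -scaler_nat !scalerA half_i_sqr.
split; try by apply: br; rewrite ?sigma_xy ?sigma_yx ?sigma_yz ?sigma_zy ?sigma_zx ?sigma_xz.
apply/eqP => /matrixP/(_ 0 1)/eqP; rewrite !mxE /= mulr1 eq_complex /=.
by rewrite oppr_eq0 mulf_eq0 invr_eq0 oner_eq0 pnatr_eq0 andbF.
Qed.

Lemma su2_combE (x y z : R) :
  x%:C%C *: su2_x + y%:C%C *: su2_y + z%:C%C *: su2_z =
  \matrix_(a, b) (if a == b then Complex 0 (if a == 0 then - (z / 2%:R) else z / 2%:R)
                  else Complex (if a == 0 then - (y / 2%:R) else y / 2%:R) (- (x / 2%:R))).
Proof.
rewrite /su2_x /su2_y /su2_z; apply/matrixP => -[[|[|//]] ?] -[[|[|//]] ?];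
  rewrite !mxE -?val_eqE /=; apply/eqP; rewrite eq_complex /=; apply/andP; split; apply/eqP;
  try by field.
Qed.

Lemma conj_complexE (x : C) : (x^*)%R = (x^*)%C.
Proof. by []. Qed.

Lemma su2_span : su R 2 = real_span3 su2_x su2_y su2_z.
Proof.
apply/seteqP; split=> A.
  case=> /matrixP Aadj; rewrite /mxtrace big_ord_recl big_ord1 => trA.
  (* Read off from [su2_combE]: the upper right entry is [- y/2 - i x/2], the upper left one
     [- i z/2]. *)
  exists (- 2%:R * complex.Im (A 0 1)), (- 2%:R * complex.Re (A 0 1)), (- 2%:R * complex.Im (A 0 0)).
  rewrite su2_combE.
  have A11 : A 1 1 = - A 0 0.
    apply/eqP; rewrite -addr_eq0 addrC -trA; apply/eqP.
    by congr (A _ _ + A _ _); apply: val_inj.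
  have := Aadj 0 1; have := Aadj 0 0; rewrite !mxE !conj_complexE.
  case E00 : (A 0 0) A11 => [p q] A11; case E01 : (A 0 1) => [p' q'].
  case E10 : (A 1 0) => [p'' q''] /= /eqP.
  rewrite eq_complex /= => /andP[/eqP pp _] /eqP.
  rewrite eq_complex /= => /andP[/eqP p''E /eqP q''E].
  have {pp} p0 : p = 0 by lra.
  have entries (B : 'M[C]_2) : A 0 0 = B 0 0 -> A 0 1 = B 0 1 -> A 1 0 = B 1 0 -> A 1 1 = B 1 1 ->
      A = B.
    move=> e00 e01 e10 e11; apply/matrixP => i j.
    case: (unliftP 0 i) => [i'|] ->; case: (unliftP 0 j) => [j'|] -> //; rewrite ?ord1.
    + by rewrite (_ : lift 0 0 = 1) //; apply: val_inj.
    + by rewrite (_ : lift 0 0 = 1) //; apply: val_inj.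
    + by rewrite (_ : lift 0 0 = 1) //; apply: val_inj.
  apply: entries; rewrite ?A11 ?E00 ?E01 ?E10 mxE /=; apply/eqP; rewrite eq_complex /=.
  - by apply/andP; split; apply/eqP; lra.
  - by apply/andP; split; apply/eqP; lra.
  - by apply/andP; split; apply/eqP; lra.
  - by apply/andP; split; apply/eqP; lra.
case=> [x [y [z ->]]]; rewrite su2_combE; split.
  apply/matrixP => -[[|[|//]] ?] -[[|[|//]] ?]; rewrite !mxE conj_complexE -?val_eqE /=;
  by apply/eqP; rewrite eq_complex /=; apply/andP; split; apply/eqP; lra.
rewrite /mxtrace big_ord_recl big_ord1 !mxE /=.
by apply/eqP; rewrite eq_complex /=; apply/andP; split; apply/eqP; lra.
Qed.


End SpecialUnitary.

(** * Roots of unity *)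

Section RootsOfUnity.
Variables (R : realType) (N : nat).
Hypothesis N_gt0 : (0 < N)%N.
Local Notation C := R[i].

(** ['X^N - 1] splits and is separable, so there are [N] distinct roots, and [N] distinct [N]-th
    roots of unity in a field include a primitive one. *)
Lemma prim_root_exists : exists w : C, N.-primitive_root w.
Proof.
have [r Dp] := closed_field_poly_normal ('X^N - 1 : {poly C}).
rewrite (monicP _) ?monicXnsubC // scale1r in Dp.
have rN1 : all N.-unity_root r by apply/allP=> z; rewrite -root_prod_XsubC -Dp.
have sz_r : (N < (size r).+1)%N by rewrite -(size_prod_XsubC r id) -Dp size_XnsubC.
have [|z] := hasP (has_prim_root N_gt0 rN1 _ sz_r); last by exists z.
by rewrite -separable_prod_XsubC -Dp separable_Xn_sub_1 // pnatr_eq0 -lt0n.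
Qed.

Lemma unity_inv_conj (z : C) : z ^+ N = 1 -> z^-1 = (z^*)%C.
Proof.
move=> zN; have norm1 : `|z| = 1.
  by apply/eqP; rewrite -(@pexpr_eq1 _ _ N) // -normrX zN normr1.
by rewrite invc_norm norm1 expr1n invr1 mul1r.
Qed.

Lemma sum_prim_root_single (V : nmodType) (w y : C) (G : C -> V) :
  N.-primitive_root w -> y ^+ N = 1 ->
  (forall z, z ^+ N = 1 -> z != y -> G z = 0) ->
  \sum_(0 <= q < N) G (w ^+ q) = G y.
Proof.
move=> w_prim yN Gz; have [i yE] := prim_rootP w_prim yN; rewrite {}yE in Gz *.
rewrite big_mkord (bigD1 i) //= big1 ?addr0 // => q neq_qi.
apply: Gz; first by rewrite exprAC (prim_expr_order w_prim) expr1n.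
by rewrite (eq_prim_root_expr w_prim) !modn_small.
Qed.

End RootsOfUnity.

(** * Decomposition of the Lie algebra of the cycle *)

Section CenterGenerators.
Variables (R : realType) (n : nat).
Hypothesis n_ge3 : (3 <= n)%N.
Local Notation C := R[i].
Local Notation M := 'M[C]_(2 ^ n).
Local Notation A := (zxz R n).
Local Notation V := (@zxz_mode R n).

Let n_gt0 : (0 < n)%N. Proof. exact: leq_trans n_ge3. Qed.

(** The reflection pairs [ZX^{k-1}Z] with [YX^{k-1}Y] and leaves [k = n] and [k = 2n], that is
    [X^{n-1}] and [-X], unpaired. *)
Lemma sum_reflect (P : pred nat) (f : nat -> M) :
  (forall k, (k <= 2 * n)%N -> P (2 * n - k)%N = P k) ->
  \sum_(1 <= k < (2 * n).+1 | P k) f k =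
  (if P (2 * n)%N then f (2 * n)%N else 0) + (if P n then f n else 0)
  + \sum_(1 <= k < n | P k) (f k + f (2 * n - k)%N).
Proof.
move=> P_sym; rewrite (@big_cat_nat _ _ _ n) //=; last by lia.
rewrite [X in _ + X = _]big_ltn_cond; last by lia.
rewrite (@big_cat_nat _ _ _ (2 * n) n.+1) //=; last by lia.
have -> : \sum_(2 * n <= k < (2 * n).+1 | P k) f k = if P (2 * n)%N then f (2 * n)%N else 0.
  by rewrite big_ltn_cond // big_geq // addr0.
have -> : \sum_(n.+1 <= k < 2 * n | P k) f k = \sum_(1 <= k < n | P k) f (2 * n - k)%N.
  rewrite big_mkcond [RHS]big_mkcond (big_addn 1 _ n) [RHS]big_nat_rev /=.
  rewrite (_ : 2 * n - n = n)%N; last by lia.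
  apply: eq_big_nat => k /andP[k_gt0 lt_kn].
  rewrite (_ : 1 + n - k.+1 = n - k)%N; last by lia.
  rewrite -(P_sym (n - k)%N); last by lia.
  by rewrite (_ : 2 * n - (n - k) = k + n)%N //; lia.
rewrite big_split /=; case: (P n).
  by rewrite [LHS](AC (1 * (1 * 2)) (4 * 2 * (1 * 3))).
by rewrite addr0 [LHS](AC (1 * 2) (3 * (1 * 2))).
Qed.

Lemma sumZXZ_sumYXY k : (0 < k < n)%N -> A k + A (2 * n - k) = sumZXZ R n k.-1 + sumYXY R n k.-1.
Proof. by move=> k_bd; rewrite zxz_sumYXY // sumZXZ_zxz prednK //; case/andP: k_bd. Qed.

(** The case distinction on [n] in [c1] and [c2] reflects which of the sums over even and odd [k]
    contains the term [k = n], namely [X^{n-1}]. *)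
Lemma c1_zxz : c1 R n = \sum_(1 <= k < (2 * n).+1 | ~~ odd k) A k.
Proof.
rewrite sum_reflect => [|k le_k2n]; last by rewrite oddB // oddM.
rewrite oddM /= zxz_sumX // zxz_sumXn1 // sum_even /c1.
have eq_sums : \sum_(1 <= t < (n.-1)./2.+1) (A (2 * t)%N + A (2 * n - 2 * t)%N) =
    \sum_(1 <= t < (n.-1)./2.+1) (sumZXZ R n (2 * t - 1) + sumYXY R n (2 * t - 1)).
  apply: eq_big_nat => t t_bd; rewrite sumZXZ_sumYXY ?subn1 //; lia.
rewrite {}eq_sums; case: ifP => [n_odd|n_even] /=.
  by rewrite addr0 (_ : (n - 1) %/ 2 = n.-1./2)%N // -divn2 subn1.
rewrite (_ : (n - 2) %/ 2 = n.-1./2)%N; last by rewrite -divn2; lia.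
by congr (_ + _); rewrite addrC.
Qed.

Lemma c2_zxz : c2 R n = \sum_(1 <= k < (2 * n).+1 | odd k) A k.
Proof.
rewrite sum_reflect => [|k le_k2n]; last by rewrite oddB // oddM.
rewrite oddM /= add0r zxz_sumXn1 // sum_odd /c2.
have eq_sums : \sum_(0 <= t < n./2) (A (2 * t).+1 + A (2 * n - (2 * t).+1)%N) =
    \sum_(0 <= t < n./2) (sumZXZ R n (2 * t) + sumYXY R n (2 * t)).
  by apply: eq_big_nat => t t_bd; rewrite sumZXZ_sumYXY //; lia.
rewrite {}eq_sums; case: ifP => [n_odd|n_even] /=.
  by rewrite (_ : ((n - 3) %/ 2).+1 = n./2)%N // -divn2; lia.
by rewrite add0r (_ : ((n - 2) %/ 2).+1 = n./2)%N // -divn2; lia.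
Qed.

Lemma zxz_mode1 : V 1 = c1 R n + c2 R n.
Proof.
rewrite -sum_zxz ?expr1n // c1_zxz c2_zxz (bigID odd) /= addrC.
by congr (_ + _); apply: eq_bigr => k _; rewrite expr1n scale1r.
Qed.

Lemma zxz_modeN1 : V (-1) = c1 R n - c2 R n.
Proof.
rewrite -sum_zxz ?exprM ?sqrrN ?expr1n // c1_zxz c2_zxz (bigID odd) /= addrC -sumrN.
congr (_ + _); apply: eq_bigr => k; rewrite -signr_odd.
  by move/negbTE->; rewrite expr0 scale1r.
by move=> ->; rewrite expr1 scaleN1r.
Qed.

End CenterGenerators.

Lemma bracket_eq0_comm (R : realType) m (A B : 'M[R[i]]_m) :
  bracket A B = 0 <-> GRing.comm A B.
Proof. by split=> [/subr0_eq|AB]; rewrite // /bracket AB subrr. Qed.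

Lemma comm_scalemx (R : realType) m (c : R[i]) (A B : 'M[R[i]]_m) :
  GRing.comm A B -> GRing.comm A (c *: B).
Proof. by rewrite /GRing.comm scalemxMl scalemxMr => ->. Qed.

Lemma real_span3_comm (R : realType) m (x y z : 'M[R[i]]_m) A B :
  GRing.comm A x -> GRing.comm A y -> GRing.comm A z -> real_span3 x y z B -> GRing.comm A B.
Proof.
by move=> Ax Ay Az [a [b [d ->]]]; do 2?[apply: commrD]; apply: comm_scalemx.
Qed.

Lemma comm_bracket (R : realType) m (A x y : 'M[R[i]]_m) :
  GRing.comm A x -> GRing.comm A y -> GRing.comm A (bracket x y).
Proof. by move=> Ax Ay; apply: commrB; apply: commrM. Qed.

(** Here [[e, f] = - 2 i r^2 H], whose bracket with [e] is [2 r^2 k f]; the normalization of [r]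
    makes this factor 1. *)
Lemma sl2_su2_triple (R : realType) m (V W : 'M[R[i]]_m) (r k : R[i]) :
  let H := bracket V W in
  bracket H V = - k *: V -> bracket H W = k *: W -> r ^+ 2 * k *+ 2 = 1 -> V != 0 ->
  let e := r *: (V + W) in let f := r *: ('i%C *: (V - W)) in
  su2_triple e f (bracket e f).
Proof.
move=> H HV HW rk V_neq0 e f.
have ii : 'i%C * 'i%C = -1 :> R[i] by rewrite -expr2 sqr_i.
have tE : bracket e f = (- (r ^+ 2 * 'i%C *+ 2)) *: H.
  rewrite /e /f !(bracketZl, bracketZr) !scalerA bracketDl !bracketDr !bracketNr !bracketxx.
  rewrite oppr0 add0r addr0 (bracketC W V) -/H -opprD -mulr2n -scaler_nat -scaleN1r !scalerA.
  by congr (_ *: _); ring.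
have HD : bracket H (V + W) = (- k) *: (V - W).
  by rewrite bracketDr HV HW scalerBr !scaleNr opprK.
have HB : bracket H (V - W) = (- k) *: (V + W).
  by rewrite bracketDr bracketNr HV HW scalerDr !scaleNr.
have te : bracket (bracket e f) e = f.
  rewrite tE /e bracketZl bracketZr HD /f !scalerA; congr (_ *: _).
  transitivity (r * 'i%C * (r ^+ 2 * k *+ 2)); first by ring.
  by rewrite rk mulr1.
have ft : bracket f (bracket e f) = e.
  rewrite bracketC tE /f bracketZl !bracketZr HB /e !scalerA -scaleNr; congr (_ *: _).
  transitivity (- ('i%C * 'i%C) * r * (r ^+ 2 * k *+ 2)); first by ring.
  by rewrite ii rk opprK !mul1r mulr1.
split=> //; apply: contra_neq V_neq0 => e0.
have r_neq0 : r != 0.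
  by apply: contra_eq_neq rk => ->; rewrite expr0n mul0r mul0rn eq_sym oner_neq0.
have f0 : f = 0 by rewrite -te e0 bracket0r.
have VW0 : V + W = 0.
  by move/eqP: e0; rewrite /e scaler_eq0 (negbTE r_neq0) => /eqP.
have VW0' : V - W = 0.
  move/eqP: f0; rewrite /f scaler_eq0 (negbTE r_neq0) scaler_eq0 complexiE.
  by rewrite (negbTE (neq0Ci _)) => /eqP.
have : V *+ 2 = 0.
  have VV : V + V = (V + W) + (V - W) by rewrite addrACA subrr addr0.
  by rewrite mulr2n VV VW0 VW0' addr0.
by move/eqP; rewrite -scaler_nat scaler_eq0 pnatr_eq0 => /eqP.
Qed.

(** * Fourier inversion and the recurrence generating all strings *)

Section Fourier.
Variables (R : realType) (n : nat).
Hypothesis n_gt0 : (0 < n)%N.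
Local Notation C := R[i].
Local Notation M := 'M[C]_(2 ^ n).
Local Notation A := (zxz R n).
Local Notation V := (@zxz_mode R n).
Local Notation N := (2 * n)%N.
Variable w : C.
Hypothesis w_prim : N.-primitive_root w.

Let N_gt0 : (0 < N)%N. Proof. by rewrite muln_gt0. Qed.

Let w_neq0 : w != 0.
Proof. by rewrite (prim_root_eq0 w_prim) -lt0n. Qed.

Let wq_unity q : (w ^+ q) ^+ N = 1.
Proof. by rewrite exprAC (prim_expr_order w_prim) expr1n. Qed.

Let wq_neq0 q : w ^+ q != 0. Proof. exact: expf_neq0. Qed.

(** The periodic extension of [zxz] from [1, ..., N] to all indices. At 0 it takes the value
    [zxz N], whereas [zxz 0] is the scalar matrix [i n]. *)
Definition zxz_fourier k : M := N%:R^-1 *: \sum_(0 <= q < N) (w ^+ q)^-1 ^+ k *: V (w ^+ q).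

Lemma zxz_fourierE k : (0 < k <= N)%N -> zxz_fourier k = A k.
Proof.
move=> k_bd; rewrite /zxz_fourier.
have -> : \sum_(0 <= q < N) (w ^+ q)^-1 ^+ k *: V (w ^+ q) =
    \sum_(1 <= l < N.+1) (\sum_(0 <= q < N) ((w^-1 ^+ k) * w ^+ l) ^+ q) *: A l.
  under eq_bigr do rewrite -sum_zxz // scaler_sumr.
  rewrite exchange_big /=; apply: eq_bigr => l _; rewrite scaler_suml.
  apply: eq_bigr => q _; rewrite scalerA; congr (_ *: _).
  by rewrite exprMn -!exprVn -!exprM mulnC [(q * l)%N]mulnC.
rewrite (bigD1_seq k) ?mem_index_iota ?iota_uniq //= [X in _ + X]big_seq_cond [X in _ + X]big1 ?addr0.
  rewrite -exprMn mulVf // expr1n sum_unity_powers ?expr1n // eqxx scalerA mulVf ?scale1r //.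
  by rewrite pnatr_eq0 -lt0n.
move=> l /andP[]; rewrite mem_index_iota => l_bd neq_lk.
rewrite sum_unity_powers; last first.
  by rewrite exprMn wq_unity mulr1 exprVn -exprVn exprAC exprVn (prim_expr_order w_prim) invr1 expr1n.
rewrite exprVn -(inj_eq (mulfI (wq_neq0 k))) mulVKf // mulr1 (eq_prim_root_expr w_prim).
case: eqP => [eq_kl|_]; last by rewrite scale0r.
(* Reduction modulo [N] is injective on [1, ..., N], but it sends [N] to 0, so this index is treated
   apart. *)
case/eqP: neq_lk; move: eq_kl; have [->|neq_kN] := eqVneq k N.
  have [-> //|neq_lN] := eqVneq l N.
  by rewrite modnn modn_small; lia.
have [->|neq_lN] := eqVneq l N; last by rewrite !modn_small; lia.
by rewrite modnn modn_small; lia.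
Qed.

Lemma zxz_fourier_periodic k : zxz_fourier (k + N) = zxz_fourier k.
Proof.
congr (_ *: _); apply: eq_bigr => q _; congr (_ *: _).
by rewrite exprD [X in _ * X]exprVn wq_unity invr1 mulr1.
Qed.

(** In the double sum only the brackets of [V z] with [V z^-1] survive, with weight [z^-1]; acting
    on [V y], only [z = y] and [z = y^-1] remain. The constant is [32 n^2 / (2n)^2 = 8]. *)
Lemma zxz_step_mode y : y ^+ N = 1 ->
  bracket (bracket (zxz_fourier 1) (zxz_fourier 0)) (V y) = (- 8%:R * (y^-1 - y)) *: V y.
Proof.
move=> yN; have y_neq0 : y != 0.
  by apply: contra_eq_neq yN => ->; rewrite expr0n (gtn_eqF N_gt0) eq_sym oner_neq0.
have -> : bracket (zxz_fourier 1) (zxz_fourier 0) =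
   (N%:R^-1 * N%:R^-1) *: \sum_(0 <= q < N) (w ^+ q)^-1 *: bracket (V (w ^+ q)) (V (w ^+ q)^-1).
  rewrite /zxz_fourier bracketZl bracketZr scalerA bracket_suml; congr (_ *: _).
  apply: eq_bigr => q _; rewrite bracketZl expr1; congr (_ *: _).
  rewrite bracket_sumr; under eq_bigr do rewrite expr0 scale1r.
  rewrite (sum_prim_root_single (y := (w ^+ q)^-1) (G := fun z => bracket (V (w ^+ q)) (V z)) w_prim) //.
    by rewrite exprVn wq_unity invr1.
  move=> z zN neq_z; apply: zxz_mode_commute => //.
  by apply: contraNneq neq_z => wz1; rewrite -[z](mulKf (wq_neq0 q)) wz1 mulr1.
rewrite bracketZl bracket_suml.
pose kap : C := - (32 * n ^ 2)%:R.
have -> : \sum_(0 <= q < N) bracket ((w ^+ q)^-1 *: bracket (V (w ^+ q)) (V (w ^+ q)^-1)) (V y)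
   = (kap * (y^-1 - y)) *: V y.
  under eq_bigr do rewrite bracketZl zxz_mode_eigen // scalerA.
  rewrite -scaler_suml; congr (_ *: _).
  under eq_bigr do rewrite mulrCA mulrBr.
  rewrite -mulr_sumr sumrB; congr (_ * (_ - _)).
    rewrite (sum_prim_root_single (y := y) (G := fun z => z^-1 * (z == y)%:R) w_prim) ?eqxx ?mulr1 //.
    by move=> z _ /negbTE->; rewrite mulr0.
  rewrite (sum_prim_root_single (y := y^-1) (G := fun z => z^-1 * (z * y == 1)%:R) w_prim).
  - by rewrite mulVf // eqxx mulr1 invrK.
  - by rewrite exprVn yN invr1.
  - move=> z _ neq_zy; case: eqP => [zy1|_]; last by rewrite mulr0.
    by case/eqP: neq_zy; apply: (mulIf y_neq0); rewrite zy1 mulVf.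
rewrite scalerA mulrA; congr (_ * _ *: _).
have nN0 : n%:R != 0 :> C by rewrite pnatr_eq0 -lt0n.
by rewrite /kap !natrM; field.
Qed.

(** On the Fourier side, multiplication by [y^-1 - y] is the difference of the two shifts of the
    index. *)
Lemma zxz_fourier_step k :
  bracket (bracket (zxz_fourier 1) (zxz_fourier 0)) (zxz_fourier k.+1) =
  - 8%:R *: (zxz_fourier k.+2 - zxz_fourier k).
Proof.
have stepD := zxz_step_mode; move: (bracket (zxz_fourier 1) (zxz_fourier 0)) stepD => D stepD.
rewrite /zxz_fourier bracketZr bracket_sumr -scalerBr [RHS]scalerA [- 8%:R * _]mulrC -[RHS]scalerA.
congr (_ *: _); rewrite -sumrB scaler_sumr; apply: eq_bigr => q _.
rewrite bracketZr stepD // -scalerBl !scalerA; congr (_ *: _).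
by rewrite !exprSr; field.
Qed.

Lemma zxz_in_lie (L : set M) : lie_subalgebra L -> L (A 1) -> L (A N) ->
  forall k, (0 < k <= N)%N -> L (A k).
Proof.
move=> [HL Lbr] LA1 LAN.
have L0 : L (zxz_fourier 0) by rewrite -zxz_fourier_periodic add0n zxz_fourierE // N_gt0 leqnn.
have L1 : L (zxz_fourier 1) by rewrite zxz_fourierE.
(* The recurrence has two steps, so the induction carries two consecutive indices, starting from the
   two generators at 0 and 1. *)
suff LF k : L (zxz_fourier k) /\ L (zxz_fourier k.+1).
  by move=> k k_bd; rewrite -zxz_fourierE //; case: (LF k).
elim: k => [//|k [LFk LFk1]]; split=> //.
have -> : zxz_fourier k.+2 = zxz_fourier k +
   (- 8%:R^-1 : R)%:C%C *: bracket (bracket (zxz_fourier 1) (zxz_fourier 0)) (zxz_fourier k.+1).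
  rewrite zxz_fourier_step scalerA rmorphN fmorphV rmorph_nat mulrNN mulVf ?pnatr_eq0 //.
  by rewrite scale1r addrC subrK.
by case: HL => _ LD LZ; apply: LD => //; apply: LZ; apply: (Lbr) => //; apply: (Lbr).
Qed.

End Fourier.

(** For [x = V z] and [y = V z^-1] this places conjugate coefficients in the real span of [mode_e z]
    and [mode_f z]. *)
Lemma scale_conj_pair (R : realType) (U : lmodType R[i]) (u : R[i]) (x y : U) :
  u *: x + (u^*)%C *: y =
  (complex.Re u)%:C%C *: (x + y) + (complex.Im u)%:C%C *: ('i%C *: (x - y)).
Proof.
rewrite scalerA !scalerDr scalerN addrACA -scalerDl -scalerBl.
by congr (_ *: _ + _ *: _); case: u => p q; apply/eqP; rewrite eq_complex /=;
  apply/andP; split; apply/eqP; ring.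
Qed.

Section LieGenerated.
Variables (R : realType) (m : nat) (S : set 'M[R[i]]_m).

Lemma lie_generated_lie : lie_subalgebra (lie_generated S).
Proof.
split; first split.
- by move=> L [[[L0 _ _] _] _].
- by move=> A B LA LB L HL; have [[[_ LD _] _] _] := HL; apply: LD; [apply: LA | apply: LB].
- by move=> a A LA L HL; have [[[_ _ LZ] _] _] := HL; apply: LZ; apply: LA.
by move=> A B LA LB L HL; have [[_ Lbr] _] := HL; apply: Lbr; [apply: LA | apply: LB].
Qed.

End LieGenerated.

(** * The components and the two inclusions *)

Section Decomposition.
Variables (R : realType) (n : nat).
Hypothesis n_ge3 : (3 <= n)%N.
Local Notation C := R[i].
Local Notation M := 'M[C]_(2 ^ n).
Local Notation A := (zxz R n).
Local Notation V := (@zxz_mode R n).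
Local Notation N := (2 * n)%N.
Variable w : C.
Hypothesis w_prim : N.-primitive_root w.

Let n_gt0 : (0 < n)%N. Proof. exact: leq_trans n_ge3. Qed.
Let N_gt0 : (0 < N)%N. Proof. by rewrite muln_gt0. Qed.

Let wq_unity q : (w ^+ q) ^+ N = 1.
Proof. by rewrite exprAC (prim_expr_order w_prim) expr1n. Qed.

Let unity_neq0 (z : C) : z ^+ N = 1 -> z != 0.
Proof.
by apply: contra_eq_neq => ->; rewrite expr0n (gtn_eqF N_gt0) eq_sym oner_neq0.
Qed.

Let unityV (z : C) : z ^+ N = 1 -> z^-1 ^+ N = 1.
Proof. by move=> zN; rewrite exprVn zN invr1. Qed.

(** The positive solution [r] of [2 * r^2 * 32 n^2 = 1], as [sl2_su2_triple] demands. *)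
Definition mode_scale : R := (8 * n)%:R^-1.
Definition mode_e (z : C) : M := mode_scale%:C%C *: (V z + V z^-1).
Definition mode_f (z : C) : M := mode_scale%:C%C *: ('i%C *: (V z - V z^-1)).
Definition mode_su2 (z : C) : set M :=
  real_span3 (mode_e z) (mode_f z) (bracket (mode_e z) (mode_f z)).

Lemma mode_su2_triple (z : C) : z ^+ N = 1 -> z * z != 1 ->
  su2_triple (mode_e z) (mode_f z) (bracket (mode_e z) (mode_f z)).
Proof.
move=> zN zz; have z_neq0 := unity_neq0 zN; have zVN := unityV zN.
apply: (sl2_su2_triple (k := (32 * n ^ 2)%:R)).
- by rewrite zxz_mode_eigen // eqxx (negbTE zz) subr0 mulr1.
- rewrite zxz_mode_eigen ?invr_eq0 // mulfV // eqxx.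
  rewrite -(inj_eq (mulfI z_neq0)) mulfV // (negbTE zz) sub0r.
  by rewrite mulrN mulr1 opprK.
- have n0 : n%:R != 0 :> C by rewrite pnatr_eq0 -lt0n.
  by rewrite /mode_scale fmorphV rmorph_nat !natrM; field.
- exact: zxz_mode_neq0.
Qed.

Lemma zxz_mode_comm (x y : C) : x ^+ N = 1 -> y ^+ N = 1 -> x * y != 1 ->
  GRing.comm (V x) (V y).
Proof. by move=> xN yN xy; apply/bracket_eq0_comm; apply: zxz_mode_commute. Qed.

Lemma comm_mode_su2 (B : M) (z : C) (D : M) :
  GRing.comm B (V z) -> GRing.comm B (V z^-1) -> mode_su2 z D -> GRing.comm B D.
Proof.
move=> Bz BzV.
have Be : GRing.comm B (mode_e z) by exact: (comm_scalemx _ (commrD Bz BzV)).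
have Bf : GRing.comm B (mode_f z) by exact: (comm_scalemx _ (comm_scalemx _ (commrB Bz BzV))).
exact: real_span3_comm Be Bf (comm_bracket Be Bf).
Qed.

(** Since [y] is neither [x] nor [x^-1], no product of [x] or [x^-1] with [y] or [y^-1] is 1, so all
    modes involved commute. *)
Lemma mode_su2_comm (x y : C) (B D : M) : x ^+ N = 1 -> y ^+ N = 1 -> x != y -> x * y != 1 ->
  mode_su2 x B -> mode_su2 y D -> bracket B D = 0.
Proof.
move=> xN yN neq_xy xy1 xB yD; apply/bracket_eq0_comm.
have x0 := unity_neq0 xN; have y0 := unity_neq0 yN.
have neq_xyV : x * y^-1 != 1.
  by apply: contraNneq neq_xy => xyV; rewrite -[x](mulfVK y0) xyV mul1r.
have neq_xVy : x^-1 * y != 1.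
  by apply: contraNneq neq_xy => xVy; rewrite -[y](mulVKf x0) xVy mulr1.
have neq_xVyV : x^-1 * y^-1 != 1 by rewrite -invfM invr_eq1.
have xVN := unityV xN; have yVN := unityV yN.
have comB (z : C) : z ^+ N = 1 -> z * x != 1 -> z * x^-1 != 1 -> GRing.comm B (V z).
  move=> zN zx zxV; apply/commr_sym.
  exact: (comm_mode_su2 (zxz_mode_comm zN xN zx) (zxz_mode_comm zN xVN zxV) xB).
apply: (comm_mode_su2 _ _ yD).
  by apply: comB; rewrite // mulrC.
by apply: comB; rewrite // mulrC.
Qed.

Definition cycle_center : set M := real_span2 (c1 R n) (c2 R n).

Lemma zxz_mode1_center : cycle_center (V 1).
Proof. by exists 1, 1; rewrite zxz_mode1 // !scale1r. Qed.

Lemma zxz_modeN1_center : cycle_center (V (-1)).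
Proof. by exists 1, (-1); rewrite zxz_modeN1 // scale1r rmorphN1 scaleN1r. Qed.

Lemma comm_cycle_center (B D : M) :
  GRing.comm B (V 1) -> GRing.comm B (V (-1)) -> cycle_center D -> GRing.comm B D.
Proof.
move=> B1 BN1 [a [b ->]].
(* The doubles of [c1] and [c2] are the sum and the difference of [V 1] and [V (-1)], so commutation
   is tested on doubles. *)
have comm_half (E : M) : GRing.comm B (E + E) -> GRing.comm B E.
  move=> BEE; have -> : E = 2%:R^-1 *: (E + E); last exact: comm_scalemx.
  rewrite scalerDr -scalerDl (_ : _ + _ = 1) ?scale1r //; by field.
apply: commrD; apply: comm_scalemx; apply: comm_half.
  have -> : c1 R n + c1 R n = V 1 + V (-1).
    by rewrite zxz_mode1 // zxz_modeN1 // addrACA subrr addr0.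
  exact: (commrD B1 BN1).
have -> : c2 R n + c2 R n = V 1 - V (-1).
  by rewrite zxz_mode1 // zxz_modeN1 // opprB [c1 R n + _]addrC addrACA subrr addr0.
exact: (commrB B1 BN1).
Qed.

Lemma N1_unity : (-1 : C) ^+ N = 1.
Proof. by rewrite exprM sqrrN !expr1n. Qed.

Lemma cycle_center_abelian (B D : M) : cycle_center B -> cycle_center D -> bracket B D = 0.
Proof.
move=> cB cD; apply/bracket_eq0_comm.
have comm1N1 : GRing.comm (V 1) (V (-1)).
  by apply: zxz_mode_comm; rewrite ?expr1n ?N1_unity // mul1r eq_sym -subr_eq0 opprK -mulr2n pnatr_eq0.
have B1 := commr_sym (comm_cycle_center (commr_refl (V 1)) comm1N1 cB).
have BN1 := commr_sym (comm_cycle_center (commr_sym comm1N1) (commr_refl (V (-1))) cB).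
exact: comm_cycle_center B1 BN1 cD.
Qed.

Lemma cycle_center_mode_su2 (z : C) (B D : M) : z ^+ N = 1 -> z * z != 1 ->
  cycle_center B -> mode_su2 z D -> bracket B D = 0.
Proof.
move=> zN zz cB zD; have z0 := unity_neq0 zN; apply/bracket_eq0_comm.
have z1 : z != 1 by apply: contraNneq zz => ->; rewrite mulr1.
have zN1 : z != -1 by apply: contraNneq zz => ->; rewrite mulrNN mulr1.
have zV1 : z^-1 != 1 by rewrite invr_eq1.
have zVN1 : z^-1 != -1 by rewrite -(inj_eq invr_inj) invrK invrN1.
have neq_opp (y : C) : y != -1 -> y * -1 != 1.
  by apply: contraNneq => <-; rewrite mulrN1 opprK.
have Bz (y : C) : y ^+ N = 1 -> y != 1 -> y != -1 -> GRing.comm B (V y).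
  move=> yN y1 yN1; have y1' : y * 1 != 1 by rewrite mulr1.
  have one_unity : (1 : C) ^+ N = 1 by rewrite expr1n.
  have cy1 := zxz_mode_comm yN one_unity y1'.
  have cyN1 := zxz_mode_comm yN N1_unity (neq_opp _ yN1).
  exact: (commr_sym (comm_cycle_center cy1 cyN1 cB)).
exact: (comm_mode_su2 (Bz _ zN z1 zN1) (Bz _ (unityV zN) zV1 zVN1) zD).
Qed.

(** Exponents [1, ..., n - 1] pick one member of each pair [{z, 1/z}] with [z ^+ 2 != 1]; exponents
    0 and [n] give 1 and -1, which belong to the center. *)
Definition cycle_component (o : option 'I_(n - 1)) : set M :=
  if o is Some j then mode_su2 (w ^+ j.+1) else cycle_center.

Lemma component_root (j : 'I_(n - 1)) : w ^+ j.+1 * w ^+ j.+1 != 1.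
Proof.
rewrite -exprD -(prim_order_dvd w_prim); apply/negP => /dvdn_leq.
have := ltn_ord j; lia.
Qed.

Lemma cycle_component_lie o : lie_subalgebra (cycle_component o).
Proof.
case: o => [j|] /=; last split; first last.
- by move=> B D cB cD; rewrite cycle_center_abelian //; have [] := real_span2_subspace (c1 R n) (c2 R n).
- exact: real_span2_subspace.
- apply: real_span3_lie; apply: mode_su2_triple => //; exact: component_root.
Qed.

Lemma cycle_component_comm o o' : o != o' ->
  forall B D, cycle_component o B -> cycle_component o' D -> bracket B D = 0.
Proof.
case: o o' => [j|] [j'|] // neq_o B D /= HB HD.
- have lt_j := ltn_ord j; have lt_j' := ltn_ord j'.
  apply: mode_su2_comm HB HD => //.
    rewrite (eq_prim_root_expr w_prim) !modn_small; try lia.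
    by apply: contraNneq neq_o => -[eq_j]; apply/eqP; congr Some; apply: val_inj.
  rewrite -exprD -(prim_order_dvd w_prim); apply/negP => /dvdn_leq; lia.
- by rewrite bracketC (cycle_center_mode_su2 _ (component_root j) HD HB) ?oppr0.
- exact: (cycle_center_mode_su2 _ (component_root j')).
Qed.

(** The inversion formula has complex coefficients. Averaging it over [w] and [w^-1] groups the
    terms into pairs with conjugate coefficients, which lie in the real components. *)
Lemma cycle_sub_component : g_cycle R n `<=` commuting_sum cycle_component.
Proof.
have sum_lie : lie_subalgebra (commuting_sum cycle_component).
  exact: (commuting_sum_lie cycle_component_lie cycle_component_comm).
have in_sum o (B : M) : cycle_component o B -> commuting_sum cycle_component B.
  exact: (commuting_sum_component cycle_component_lie).
have [sum_sub _] := sum_lie; have [_ sumD sumZ] := sum_sub.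
have conj_pow (z : C) k : z ^+ N = 1 -> z ^+ k = ((z^-1 ^+ k)^*)%C.
  move=> zN; rewrite -(unity_inv_conj N_gt0).
    by rewrite exprVn invrK.
  by rewrite exprAC unityV // expr1n.
have in_su2 (z : C) k : z ^+ N = 1 -> mode_su2 z (z^-1 ^+ k *: V z + z ^+ k *: V z^-1).
  move=> zN; rewrite (conj_pow z k zN); set u := z^-1 ^+ k.
  have scale0 : mode_scale != 0 by rewrite invr_eq0 pnatr_eq0 -lt0n muln_gt0.
  have cancel_scale (a : R) (B : M) :
      (a / mode_scale)%:C%C *: (mode_scale%:C%C *: B) = a%:C%C *: B.
    by rewrite scalerA -rmorphM /= divfK.
  exists (complex.Re u / mode_scale), (complex.Im u / mode_scale), 0.
  by rewrite scale0r addr0 !cancel_scale -scale_conj_pair.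
have pair_in (q k : nat) : (q < N)%N ->
    commuting_sum cycle_component ((w ^+ q)^-1 ^+ k *: V (w ^+ q) + (w ^+ q) ^+ k *: V (w ^+ q)^-1).
  move=> lt_qN; have [q0|q_gt0] := posnP q.
    rewrite q0 expr0 invr1 expr1n !scale1r; apply: sumD; exact: (in_sum None _ zxz_mode1_center).
  have wn : w ^+ n = -1.
    have : (w ^+ n) ^+ 2 = 1 by rewrite -exprM mulnC (prim_expr_order w_prim).
    move/eqP; rewrite sqrf_eq1 => /orP[|/eqP//].
    by rewrite -(prim_order_dvd w_prim) => /dvdn_leq; lia.
  (* For [q] beyond [n] the root is the inverse of the one with exponent [N - q], and the paired
     term is symmetric under inversion. *)
  have [lt_qn|lt_nq|->] := ltngtP q n.
  - have lt_q1 : (q.-1 < n - 1)%N by lia.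
    apply: (in_sum (Some (Ordinal lt_q1))) => /=; rewrite prednK //.
    exact: in_su2.
  - have lt_q1 : ((N - q).-1 < n - 1)%N by lia.
    apply: (in_sum (Some (Ordinal lt_q1))) => /=; rewrite prednK; last by lia.
    have -> : w ^+ (N - q) = (w ^+ q)^-1.
      apply: (mulfI (unity_neq0 (wq_unity q))); rewrite -exprD subnKC ?(ltnW lt_qN) //.
      by rewrite (prim_expr_order w_prim) mulfV // unity_neq0.
    rewrite addrC; have := in_su2 (w ^+ q)^-1 k (unityV (wq_unity q)).
    by rewrite invrK.
  - rewrite wn invrN1 -mulr2n -scaler_nat scalerA -signr_odd.
    apply: in_sum None _ _; have [_ _ cZ] := real_span2_subspace (c1 R n) (c2 R n).
    have -> : 2%:R * (-1) ^+ odd k = (2%:R * (-1) ^+ odd k : R)%:C%C :> C.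
      by rewrite rmorphM rmorph_nat rmorph_sign.
    by apply: cZ; apply: zxz_modeN1_center.
have zxz_in k : (0 < k <= N)%N -> commuting_sum cycle_component (A k).
  move=> k_bd.
  have wV_prim : N.-primitive_root w^-1.
    have -> : w^-1 = w ^+ N.-1.
      have w_neq0 := unity_neq0 (prim_expr_order w_prim).
      by apply: (mulfI w_neq0); rewrite -exprS prednK // (prim_expr_order w_prim) mulfV.
    by rewrite prim_root_exp_coprime // -{2}[N]prednK // coprimenS.
  have AE := zxz_fourierE n_gt0 w_prim k_bd.
  have AE' : N%:R^-1 *: (\sum_(0 <= q < N) (w ^+ q) ^+ k *: V (w ^+ q)^-1) = A k.
    have sumE : \sum_(0 <= q < N) (w ^+ q) ^+ k *: V (w ^+ q)^-1 =
        \sum_(0 <= q < N) (w^-1 ^+ q)^-1 ^+ k *: V (w^-1 ^+ q).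
      by apply: eq_bigr => q _; rewrite [w^-1 ^+ q]exprVn invrK.
    exact: etrans (congr1 (fun B => N%:R^-1 *: B) sumE) (zxz_fourierE n_gt0 wV_prim k_bd).
  have half (E : M) : E = 2%:R^-1 *: (E + E).
    by rewrite scalerDr -scalerDl (_ : _ + _ = 1) ?scale1r //; field.
  have -> : A k = ((2 * N)%:R^-1 : R)%:C%C *:
      \sum_(0 <= q < N) ((w ^+ q)^-1 ^+ k *: V (w ^+ q) + (w ^+ q) ^+ k *: V (w ^+ q)^-1).
    have -> : ((2 * N)%:R^-1 : R)%:C%C = 2%:R^-1 * N%:R^-1 :> C.
      by rewrite fmorphV rmorph_nat natrM invfM.
    have average (B D : M) : N%:R^-1 *: B = A k -> N%:R^-1 *: D = A k ->
        (2%:R^-1 * N%:R^-1) *: (B + D) = A k.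
      by move=> BA DA; rewrite -scalerA scalerDr BA DA -half.
    by rewrite big_split; apply/esym; apply: (average _ _ AE AE').
  apply: sumZ; rewrite big_mkord; apply: real_subspace_sum => // q _.
  exact: pair_in.
apply: smallest_sub => // _ [->|->].
- rewrite -[sumX R n]opprK -zxz_sumX //; apply: real_subspaceN => //.
  by apply: zxz_in; rewrite N_gt0 leqnn.
- by rewrite sumZZ_zxz; apply: zxz_in.
Qed.

Lemma component_sub_cycle : commuting_sum cycle_component `<=` g_cycle R n.
Proof.
have L_lie := lie_generated_lie [set sumX R n; sumZZ R n].
have [L_sub Lbr] := L_lie; have [_ LD LZ] := L_sub.
have LA k : (0 < k <= N)%N -> g_cycle R n (A k).
  apply: (zxz_in_lie n_gt0 w_prim L_lie).
    by rewrite -sumZZ_zxz => L [_]; apply; right.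
  rewrite zxz_sumX //; apply: (real_subspaceN L_sub).
  by move=> L [_]; apply; left.
have Lsum (P : pred nat) (f : nat -> R) :
    g_cycle R n (\sum_(1 <= k < N.+1 | P k) (f k)%:C%C *: A k).
  rewrite big_nat_cond; apply: real_subspace_sum => // k /andP[k_bd _].
  by apply: LZ; apply: LA.
have Lc1 : g_cycle R n (c1 R n).
  rewrite c1_zxz //; under eq_bigr do rewrite -[A _]scale1r.
  exact: (Lsum _ (fun=> 1)).
have Lc2 : g_cycle R n (c2 R n).
  rewrite c2_zxz //; under eq_bigr do rewrite -[A _]scale1r.
  exact: (Lsum _ (fun=> 1)).
(* A complex combination of modes lies in the real algebra as soon as its coefficient at every [A k]
   is real. *)
have Lmode (z c d : C) : z ^+ N = 1 ->
    (forall k, exists a : R, c * z ^+ k + d * z^-1 ^+ k = a%:C%C) ->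
    g_cycle R n (c *: V z + d *: V z^-1).
  move=> zN /boolp.choice[a aE]; rewrite -!sum_zxz ?unityV // !scaler_sumr -big_split /=.
  rewrite (eq_bigr (fun k => (a k)%:C%C *: A k)) => [|k _]; first exact: (Lsum xpredT a).
  by rewrite -aE scalerDl !scalerA.
have conjV (z : C) k : z ^+ N = 1 -> z^-1 ^+ k = ((z ^+ k)^*)%C.
  by move=> zN; rewrite -(unity_inv_conj N_gt0) ?exprVn // exprAC zN expr1n.
have Le (z : C) : z ^+ N = 1 -> g_cycle R n (mode_e z).
  move=> zN; rewrite /mode_e -[V z]scale1r -[V z^-1]scale1r; apply: LZ.
  apply: Lmode => // k; exists (2%:R * complex.Re (z ^+ k)).
  by rewrite !mul1r conjV // addcJ rmorphM rmorph_nat.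
have Lf (z : C) : z ^+ N = 1 -> g_cycle R n (mode_f z).
  move=> zN; rewrite /mode_f scalerBr -scaleNr; apply: LZ.
  (* [i] times the difference of a number and its conjugate is [- 2] times its imaginary part. *)
  apply: Lmode => // k; exists (- 2%:R * complex.Im (z ^+ k)).
  rewrite [- 'i%C * _]mulNr -mulrBr conjV // subcJ rmorphM rmorphN rmorph_nat [LHS]mulrC.
  by rewrite -[LHS]mulrA -expr2 sqr_i mulrN1 mulNr.
move=> _ [B cB ->]; apply: (@real_subspace_sum _ _ _ _ _ xpredT) => // -[j|] _; last first.
  have [a [b ->]] := cB None; apply: LD; apply: LZ => //.
have [a [b [d ->]]] := cB (Some j).
have LeJ := Le _ (wq_unity j.+1); have LfJ := Lf _ (wq_unity j.+1).
apply: (LD _ _ (LD _ _ (LZ _ _ LeJ) (LZ _ _ LfJ))).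
exact: (LZ _ _ (Lbr _ _ LeJ LfJ)).
Qed.

End Decomposition.

Theorem theorem3 (R : realType) (n : nat) (hn : (3 <= n)%N) :
  exists (c : set 'M[R[i]]_(2 ^ n)) (g : 'I_(n - 1) -> set 'M[R[i]]_(2 ^ n)),
    [/\ lie_direct_sum (g_cycle R n)
          (fun k : option 'I_(n - 1) => if k is Some j then g j else c),
        forall j, lie_isomorphic (g j) (su R 2),
        c = lie_center (g_cycle R n) &
        c = real_span2 (c1 R n) (c2 R n)].
Proof.
have n_gt0 : (0 < n)%N by apply: leq_trans hn.
have N_gt0 : (0 < 2 * n)%N by rewrite muln_gt0.
have [w w_prim] := prim_root_exists R N_gt0.
have triple (j : 'I_(n - 1)) : su2_triple (mode_e n (w ^+ j.+1)) (mode_f n (w ^+ j.+1))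
    (bracket (mode_e n (w ^+ j.+1)) (mode_f n (w ^+ j.+1))).
  apply: mode_su2_triple => //; last exact: component_root w_prim j.
  by rewrite exprAC (prim_expr_order w_prim) expr1n.
have centerless (j : 'I_(n - 1)) A : @mode_su2 R n (w ^+ j.+1) A ->
    (forall B, @mode_su2 R n (w ^+ j.+1) B -> bracket A B = 0) -> A = 0.
  exact: (real_span3_centerless (triple j)).
have gE : g_cycle R n = commuting_sum (cycle_component w).
  by apply/seteqP; split; [apply: cycle_sub_component | apply: component_sub_cycle].
have V_lie := cycle_component_lie hn w_prim.
have V_comm := cycle_component_comm hn w_prim.
have c_abelian := cycle_center_abelian hn.
exists (@cycle_center R n), (fun j => @mode_su2 R n (w ^+ j.+1)); split.
- by rewrite gE; apply: (commuting_sum_direct V_lie V_comm centerless).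
- by move=> j; rewrite su2_span; apply: (su2_triple_isomorphic (triple j) (su2_basis_triple R)).
- by rewrite gE; apply: (commuting_sum_center V_lie V_comm _ centerless); apply: c_abelian.
- by [].
Qed.
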